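(* Let $K$ be an algebraically closed field of arbitrary characteristic, and let $d$ and $n$ be integers such that $3\le n\le\binom{d+2}{2}$ and $(d,n)\ne(2,5)$. Then there is a family of $n$ monomials in $K[X_0,X_1,X_2]$ of degree $d$ such that their syzygy bundle on $\mathbb{P}^2$ is stable. If $(d,n)=(2,5)$, there is a family of $n$ monomials of degree $d$ such that their syzygy bundle is semistable.
   Context: $\mathbb{P}^2$ is the projective plane over $K$ and $\mathcal{O}=\mathcal{O}_{\mathbb{P}^2}$. Degrees $d$ are positive integers. A family of $n$ monomials means $n$ distinct monic monomials. Syzygy bundle: if $f_1,\ldots,f_n\in K[X_0,X_1,X_2]$ are homogeneous of degree $d$ and the ideal $(f_1,\ldots,f_n)$ is $\mathfrak{m}$-primary, where $\mathfrak{m}=(X_0,X_1,X_2)$, then the syzygy bundle $\mathrm{Syz}(f_1,\ldots,f_n)$ is the kernel of the morphism $\mathcal{O}(-d)^n\to\mathcal{O}$, $(g_1,\ldots,g_n)\mapsto f_1g_1+\cdots+f_ng_n$; it is a vector bundle of rank $n-1$. Saying that a family has a (stable, semistable) syzygy bundle includes the requirement that the ideal it generates is $\mathfrak{m}$-primary. Stability: for a torsion-free coherent sheaf $E$ on $\mathbb{P}^2$ of rank $r>0$, the slope is $\mu(E)=c_1(E)/r$. $E$ is semistable (in the sense of Mumford–Takemoto) if $\mu(F)\le\mu(E)$ for every coherent subsheaf $F\subset E$ with $0<\mathrm{rk}\,F<\mathrm{rk}\,E$, and stable if the inequality is always strict. *)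

(* Defs.v *)
From HB Require Import structures.
From mathcomp Require Import all_boot all_order all_algebra.
From mathcomp Require Import mpoly.

Set Implicit Arguments.
Unset Strict Implicit.
Unset Printing Implicit Defensive.

Import Order.TTheory GRing.Theory Num.Theory.
Local Open Scope ring_scope.

(* The projective plane over an algebraically closed field K is treated as a
   classical variety, as in Serre's FAC: its points are the nonzero vectors of
   K^3 up to scalars, with the Zariski topology.  A subset of P^2 is
   represented by the cone over it, minus the origin. *)

Definition region (K : closedFieldType) := 'rV[K]_3 -> Prop.

Definition ev (K : closedFieldType) (p : {mpoly K[3]}) (x : 'rV[K]_3) : K :=
  p.@[fun i => x 0 i].

(* The complement of the common zero locus of a set B of homogeneous
   polynomials; the right-hand side is automatically invariant under
   scaling of x. *)
Definition zopen (K : closedFieldType) (U : region K) : Prop :=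
  exists2 B : {mpoly K[3]} -> Prop,
    (forall p, B p -> exists k, p \is k.-homog) &
    (forall x, U x <-> x != 0 /\ exists2 p, B p & ev p x != 0).

Definition subregion (K : closedFieldType) (V U : region K) : Prop :=
  forall x, V x -> U x.

Definition P2 (K : closedFieldType) : region K := fun x => x != 0.

(* The sections of O(e) over U are the functions on the cone over U that are
   locally quotients of homogeneous polynomials, of total degree e; for e = 0
   these are the regular functions on U.  Functions are total, but only their
   values on U are meaningful. *)
Definition section_O (K : closedFieldType) (e : int) (U : region K)
    (s : 'rV[K]_3 -> K) : Prop :=
  forall x, U x -> exists V p q k l,
    [/\ zopen V, subregion V U & V x] /\
    [/\ p \is k.-homog, q \is l.-homog, k%:Z - l%:Z = e &
        forall y, V y -> ev q y != 0 /\ s y = ev p y / ev q y].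

Definition section_On (K : closedFieldType) (n : nat) (e : int) (U : region K)
    (s : 'rV[K]_3 -> 'rV[K]_n) : Prop :=
  forall i, section_O e U (fun x => s x 0 i).

(* F U s reads: s is a section of F over U. *)
Definition sections (K : closedFieldType) (n : nat) :=
  region K -> ('rV[K]_3 -> 'rV[K]_n) -> Prop.

(* An O-submodule sheaf of O(e)^n.  Since O(e)^n is a sheaf of functions, the
   gluing axiom amounts to membership in F being a local condition; with
   W = U, [subsheaf_restr] also says that F U s depends only on the values of
   s on U. *)
Record subsheaf (K : closedFieldType) (n : nat) (e : int)
    (F : sections K n) : Prop := Subsheaf {
  subsheaf_section : forall U s, zopen U -> F U s -> section_On e U s;
  subsheaf_zero : forall U, zopen U -> F U (fun=> 0);
  subsheaf_add : forall U s t, zopen U -> F U s -> F U t ->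
    F U (fun x => s x + t x);
  subsheaf_scale : forall U g s, zopen U -> section_O 0 U g -> F U s ->
    F U (fun x => g x *: s x);
  subsheaf_restr : forall U W s t, zopen U -> zopen W -> subregion W U ->
    F U s -> (forall x, W x -> t x = s x) -> F W t;
  subsheaf_glue : forall U s, zopen U ->
    (forall x, U x -> exists V, [/\ zopen V, subregion V U, V x & F V s]) ->
    F U s
}.

(* Locally on P^2 there is a surjection of sheaves O^k -> F. *)
Definition finite_type (K : closedFieldType) (n : nat)
    (F : sections K n) : Prop :=
  forall x, P2 x -> exists V (k : nat) (g : 'I_k -> 'rV[K]_3 -> 'rV[K]_n),
    [/\ zopen V, V x, forall j, F V (g j) &
      forall W t, zopen W -> subregion W V -> F W t ->
      forall y, W y -> exists W' (a : 'I_k -> 'rV[K]_3 -> K),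
        [/\ zopen W', subregion W' W, W' y, forall j, section_O 0 W' (a j) &
            forall z, W' z -> t z = \sum_j a j z *: g j z]].

(* The sheaf O on P^2 is coherent, so a subsheaf of finite type of O(e)^n is
   coherent.  It is torsion-free since O(e)^n is. *)
Definition coherent_subsheaf (K : closedFieldType) (n : nat) (e : int)
    (F : sections K n) : Prop :=
  subsheaf e F /\ finite_type F.

Definition sub_sections (K : closedFieldType) (n : nat)
    (F E : sections K n) : Prop :=
  forall U s, zopen U -> F U s -> E U s.

(* The generic rank: F is isomorphic to O^r over some nonempty open set. *)
Definition is_rank (K : closedFieldType) (n : nat) (F : sections K n)
    (r : nat) : Prop :=
  exists U (b : 'I_r -> 'rV[K]_3 -> 'rV[K]_n),
    [/\ zopen U, exists x, U x, forall j, F U (b j) &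
      forall V, zopen V -> subregion V U ->
        (forall a : 'I_r -> 'rV[K]_3 -> K, (forall j, section_O 0 V (a j)) ->
           (forall x, V x -> \sum_j a j x *: b j x = 0) ->
           forall j x, V x -> a j x = 0) /\
        (forall t, F V t -> exists a : 'I_r -> 'rV[K]_3 -> K,
           (forall j, section_O 0 V (a j)) /\
           (forall x, V x -> t x = \sum_j a j x *: b j x))].

(* For F in O(e)^n, the twist F(k) = F (x) O(k) as a subsheaf of O(e + k)^n:
   a section belongs to F(k) when its products with all local sections of
   O(-k) belong to F. *)
Definition twist (K : closedFieldType) (n : nat) (e : int) (F : sections K n)
    (k : int) : sections K n :=
  fun U s => section_On (e + k) U s /\
    forall V g, zopen V -> subregion V U -> section_O (- k) V g ->
      F V (fun x => g x *: s x).

(* The K-vector space H^0(P^2, F) has dimension h. *)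
Definition is_h0 (K : closedFieldType) (n : nat) (F : sections K n)
    (h : nat) : Prop :=
  exists b : 'I_h -> 'rV[K]_3 -> 'rV[K]_n,
    (forall j, F (@P2 K) (b j)) /\
    (forall t, F (@P2 K) t ->
       exists! c : 'rV[K]_h, forall x, P2 x -> t x = \sum_j c 0 j *: b j x).

(* The first Chern class, identified with an integer through Pic P^2 = Z and
   read off the Hilbert polynomial: by Riemann-Roch and Serre vanishing, for a
   coherent F of rank r and all large k,
     h^0(F(k)) = chi(F(k)) = r * chi(O(k)) + c_1(F) * k + constant.
   For every coherent subsheaf F of O(e)^n exactly one c has this property. *)
Definition is_c1 (K : closedFieldType) (n : nat) (e : int) (F : sections K n)
    (c : int) : Prop :=
  exists r : nat, is_rank F r /\
  exists (k0 : nat) (a : int), forall k : nat, (k0 <= k)%N ->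
  exists2 h : nat, is_h0 (twist e F k%:Z) h &
    h%:Z = r%:Z * 'C(k + 2, 2)%:Z + c * k%:Z + a.

Definition is_slope (K : closedFieldType) (n : nat) (e : int)
    (F : sections K n) (mu : rat) : Prop :=
  exists (r : nat) (c : int),
    [/\ (0 < r)%N, is_rank F r, is_c1 e F c & mu = c%:~R / r%:R].

(* Mumford-Takemoto (semi)stability of a sheaf E given as a subsheaf of
   O(e)^n; the coherent subsheaves of E are then the coherent subsheaves of
   O(e)^n contained in E. *)
Definition semistable (K : closedFieldType) (n : nat) (e : int)
    (E : sections K n) : Prop :=
  coherent_subsheaf e E /\
  exists (R : nat) (muE : rat), [/\ is_rank E R, is_slope e E muE &
    forall (F : sections K n) (r : nat) (muF : rat),
      coherent_subsheaf e F -> sub_sections F E ->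
      is_rank F r -> (0 < r < R)%N -> is_slope e F muF -> muF <= muE].

Definition stable (K : closedFieldType) (n : nat) (e : int)
    (E : sections K n) : Prop :=
  coherent_subsheaf e E /\
  exists (R : nat) (muE : rat), [/\ is_rank E R, is_slope e E muE &
    forall (F : sections K n) (r : nat) (muF : rat),
      coherent_subsheaf e F -> sub_sections F E ->
      is_rank F r -> (0 < r < R)%N -> is_slope e F muF -> muF < muE].

Definition in_ideal (K : closedFieldType) (n : nat)
    (f : 'I_n -> {mpoly K[3]}) (p : {mpoly K[3]}) : Prop :=
  exists g : 'I_n -> {mpoly K[3]}, p = \sum_i g i * f i.

(* The ideal generated by the f i is primary with radical (X_0, X_1, X_2). *)
Definition m_primary (K : closedFieldType) (n : nat)
    (f : 'I_n -> {mpoly K[3]}) : Prop :=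
  [/\ ~ in_ideal f 1,
      forall p q, in_ideal f (p * q) ->
        in_ideal f p \/ exists k : nat, in_ideal f (q ^+ k) &
      forall p, (exists k : nat, in_ideal f (p ^+ k)) <->
                in_ideal (fun i : 'I_3 => 'X_i) p].

(* The kernel of (f_1, ..., f_n) : O(-d)^n -> O. *)
Definition Syz (K : closedFieldType) (n d : nat) (f : 'I_n -> {mpoly K[3]}) :
    sections K n :=
  fun U s => section_On (- d%:Z) U s /\
    forall x, U x -> \sum_i ev (f i) x * s x 0 i = 0.

Definition monomial_family (n d : nat) (m : 'I_n -> 'X_{1..3}) : Prop :=
  injective m /\ forall i, mdeg (m i) = d.

Definition monomials (K : closedFieldType) (n : nat) (m : 'I_n -> 'X_{1..3}) :
    'I_n -> {mpoly K[3]} := fun i => 'X_[m i].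

(* Main.v *)
From HB Require Import structures.
Require Import Defs.
From mathcomp Require Import all_boot all_order all_algebra.
From mathcomp Require Import mpoly.
From mathcomp Require Import zify ring.
From Stdlib Require Import Classical_Prop.

(**
  Klyachko and Brenner: let [F] be a coherent subsheaf of rank [r] of the syzygy
  bundle of monomials [X^m_i].  Recording the coefficients of [X^u] in
  [(X^m_i g_i)_i], a global section of [F(k)] is a family of vectors of [K^n]
  indexed by the monomials [u] of degree [k].  Taking the vector at the largest
  [u] where it is nonzero degenerates [F] to a torus-equivariant subsheaf with
  the same Hilbert function, given by a subspace [W] of [K^n] of dimension [r]
  on which the sum of the coordinates vanishes, filtered by the exponents of
  the [X_j].  Hence [- c_1(F) >= phi W], where [phi W] sums over [j] and [t] the
  ranks on [W] of the sets of coordinates [i] with [m_i(j) > t].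

  If [C] is a circuit of the coordinates on [W], then
  [phi W >= d |C| - deg gcd(X^m_i, i in C) + phi W'], where [W'] is the subspace
  of [W] vanishing on [C].  By induction, stability follows from the
  inequalities [(n - 1)(d - deg gcd) > d (|C| - 1)] for [2 <= |C| < n]: in the
  triangle of exponents, a subtriangle of side [k < d] contains fewer than
  [1 + k (n - 1) / d] points of the family.

  Such families are found by spreading points along the three edges of the
  triangle when [n <= 3 d], and by filling consecutive rows, the last one
  partially and evenly, and adding the opposite vertex when [n > 3 d].
*)

(** Since [is_c1] reads the Chern class off [h^0] of large twists, everything is moved to graded
    polynomial algebra: global sections of [O(e)] are forms of degree [e]. The usual route shows
    that a canonical destabilizing subsheaf is torus-invariant; taking leading coefficients instead
    treats an arbitrary [F] and preserves [h^0] in every large degree. The price is a mere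
    inequality for [c_1], in the direction that stability needs: the quadratic terms of the Hilbert
    functions give [dim W = r], the linear ones the bound by [phi W]. For [|C| = n] the gcd is 1 and
    the inequality would read [(n - 1) d > (n - 1) d]; such a circuit is excluded by
    [|C| - 1 <= r < n - 1]. Three is the least positive number of full rows for which the number of
    points divided by the side does not decrease as the side grows. Three rows hold [3 d] points, as
    many as the boundary: hence the threshold between the two constructions. *)

Set Implicit Arguments.
Unset Strict Implicit.
Unset Printing Implicit Defensive.

(** * Balanced configurations of points in a triangle *)

(* A point (a, b) with a + b <= d stands for the monomial
   X_0^a X_1^b X_2^(d - a - b), which is divisible by X_0^x X_1^y X_2^z when
   [in_corner d x y z (a, b)]. *)
Definition in_corner (d x y z : nat) (p : nat * nat) : bool :=
  [&& x <= p.1, y <= p.2 & z + p.1 + p.2 <= d]%N.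

(* The slack delta is 1 for stability and 0 for semistability. *)
Definition balanced (d delta : nat) (s : seq (nat * nat)) : Prop :=
  [/\ uniq s, {in s, forall p, p.1 + p.2 <= d}%N,
      [/\ (d, 0) \in s, (0, d) \in s & (0, 0) \in s]%N &
      forall x y z, (0 < x + y + z < d)%N ->
        (d * count (in_corner d x y z) s + delta <=
           d + (size s).-1 * (d - (x + y + z)))%N].

Lemma double_bin2 j : 'C(j + 2, 2) * 2 = (j + 2) * (j + 1).
Proof. by rewrite addn2 addn1 mulnC -(mul_bin_diag j.+2 1) bin1. Qed.

Lemma count_interval (lo hi : nat) (s : seq nat) : uniq s ->
  count (fun p => lo <= p <= hi) s <= hi.+1 - lo.
Proof.
move=> us; rewrite -size_filter -[X in _ <= X](size_iota lo).
apply: uniq_leq_size; first exact: filter_uniq.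
by move=> p; rewrite mem_filter mem_iota => /andP[/andP[? ?] _]; lia.
Qed.

(** Reduces counting to the extreme indices [i] and [j] satisfying [P]: when positions grow at a
    known rate with the index, a bound on [j - i] bounds the count. *)
Lemma count_iota_spread (P : pred nat) a l : 0 < count P (iota a l) ->
  exists i j, [/\ a <= i, j < a + l, P i, P j & count P (iota a l) <= j.+1 - i].
Proof.
move=> c0; have hP : has P (iota a l) by rewrite has_count.
set s := filter P (iota a l).
have ss : sorted leq s by apply: sorted_filter (iota_sorted _ _); apply: leq_trans.
have us : uniq s by rewrite filter_uniq ?iota_uniq.
have s0 : 0 < size s by rewrite size_filter.
have smem p : p \in s -> [/\ P p, a <= p & p < a + l].
  by rewrite mem_filter mem_iota => /and3P[].
have lt0 : (size s).-1 < size s by rewrite prednK.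
have [Pi ai _] := smem _ (mem_nth 0 s0); have [Pj _ jl] := smem _ (mem_nth 0 lt0).
exists (nth 0 s 0), (nth 0 s (size s).-1); split=> //.
rewrite -size_filter -/s -[X in _ <= X](size_iota (nth 0 s 0)).
apply: uniq_leq_size => // p ps; rewrite mem_iota.
have nthS := sorted_leq_nth leq_trans leqnn 0 ss.
have lti : index p s < size s by rewrite index_mem.
have := nthS 0 (index p s) s0 lti (leq0n _); rewrite nth_index // => le1.
have := nthS (index p s) (size s).-1 lti lt0; rewrite nth_index // => le2.
have {}le2 : p <= nth 0 s (size s).-1 by apply: le2; lia.
by lia.
Qed.

(* The edges are oriented cyclically: each vertex ends one edge and starts the
   next one. *)
Definition edge_points (d : nat) (P0 P1 P2 : seq nat) : seq (nat * nat) :=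
  [:: (d, 0); (0, d); (0, 0)] ++ [seq (p, 0) | p <- P0] ++
  [seq (d - p, p) | p <- P1] ++ [seq (0, d - p) | p <- P2].

Definition inner_positions (d : nat) (P : seq nat) :=
  uniq P /\ {in P, forall p, 0 < p < d}.

(** The condition on a corner of side [hi - lo] that meets the boundary in a window of a single
    edge; [m] stands for the size of the family minus one. *)
Definition sparse_edge (d m : nat) (P : seq nat) := forall lo hi, lo < hi < d ->
  d * count (fun p => lo <= p <= hi) P < d + m * (hi - lo).

(** The condition on a corner of side [k] at a vertex, which meets the end of [P] and the start of
    [Q]. The vertex itself uses up the summand [d] on the right of [balanced]. *)
Definition sparse_vertex (d m : nat) (P Q : seq nat) := forall k, 0 < k < d ->
  d * (count (fun p => d - k <= p) P + count (fun p => p <= k) Q) < m * k.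

(** * Families on the edges of the triangle *)

Section Edges.
Variables (d : nat) (P0 P1 P2 : seq nat).
Local Notation m := (size P0 + size P1 + size P2).+2.

Lemma size_edge_points : size (edge_points d P0 P1 P2) = m.+1.
Proof. by rewrite !size_cat !size_map /=; lia. Qed.

Hypothesis d_gt0 : 0 < d.
Hypotheses (in0 : inner_positions d P0) (in1 : inner_positions d P1)
  (in2 : inner_positions d P2).
Hypotheses (ed0 : sparse_edge d m P0) (ed1 : sparse_edge d m P1) (ed2 : sparse_edge d m P2).
Hypotheses (ve0 : sparse_vertex d m P0 P1) (ve1 : sparse_vertex d m P1 P2)
  (ve2 : sparse_vertex d m P2 P0).

Lemma uniq_edge_points : uniq (edge_points d P0 P1 P2).
Proof.
have [[u0 i0] [u1 i1] [u2 i2]] := And3 in0 in1 in2.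
rewrite !cat_uniq !map_inj_in_uniq ?u0 ?u1 ?u2 => [|p q /i2 ? /i2 ? [] ||p q _ _ []] //; last 2 first.
- lia.
- by move=> p q _ _ [].
rewrite /= !inE !xpair_eqE !andbT; apply/and4P; split.
- lia.
- apply/hasPn => p; rewrite !mem_cat => /or3P[] /mapP[q] /[dup] qP => [/i0|/i1|/i2] ? ->;
  rewrite !inE !xpair_eqE; lia.
- apply/hasPn => p; rewrite mem_cat => /orP[] /mapP[q] /[dup] qP => [/i1|/i2] ? ->;
  apply/negP => /mapP[q' /i0 ? []]; lia.
- apply/hasPn => p /mapP[q] /i2 ? ->; apply/negP => /mapP[q' /i1 ? []]; lia.
Qed.

(** The number of positive entries among [x], [y], [z] decides: three leave no boundary point, two
    leave a window of one edge, one leaves a vertex with the two edges through it. *)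
Lemma balanced_edges : balanced d 1 (edge_points d P0 P1 P2).
Proof.
have [[u0 i0] [u1 i1] [u2 i2]] := And3 in0 in1 in2.
split; first exact: uniq_edge_points.
- move=> p; rewrite !inE !mem_cat => /or4P[/eqP ->|/eqP ->|/eqP ->|] /=; try lia.
  by case/or3P => /mapP[q] /[dup] qP => [/i0|/i1|/i2] ? -> /=; lia.
- by rewrite !inE !eqxx !orbT.
move=> x y z xyz; rewrite size_edge_points !count_cat !count_map /=.
set c0 := count _ P0; set c1 := count _ P1; set c2 := count _ P2.
have c0E : c0 = (y == 0) * count (fun p => x <= p <= d - z) P0.
  case: eqP => [y0|y0]; rewrite ?mul1n ?mul0n.
    by apply: eq_in_count => p /i0; rewrite /in_corner /=; lia.
  by apply/eqP; rewrite -leqn0 leqNgt -has_count; apply/hasPn => p _; rewrite /in_corner /=; lia.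
have c1E : c1 = (z == 0) * count (fun p => y <= p <= d - x) P1.
  case: eqP => [z0|z0]; rewrite ?mul1n ?mul0n.
    by apply: eq_in_count => p /i1; rewrite /in_corner /=; lia.
  by apply/eqP; rewrite -leqn0 leqNgt -has_count; apply/hasPn => p /i1; rewrite /in_corner /=; lia.
have c2E : c2 = (x == 0) * count (fun p => z <= p <= d - y) P2.
  case: eqP => [x0|x0]; rewrite ?mul1n ?mul0n.
    by apply: eq_in_count => p /i2; rewrite /in_corner /=; lia.
  by apply/eqP; rewrite -leqn0 leqNgt -has_count; apply/hasPn => p /i2; rewrite /in_corner /=; lia.
rewrite c0E c1E c2E /in_corner /=.
have tail P lo hi : {in P, forall p, 0 < p < d} -> d <= hi ->
    count (fun p => lo <= p <= hi) P = count (fun p => lo <= p) P.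
  by move=> iP dh; apply: eq_in_count => p /iP; lia.
set tot := (X in d * X + 1 <= _).
have [x0|x0] := posnP x; have [y0|y0] := posnP y; have [z0|z0] := posnP z; try lia.
- have zd : 0 < d - z < d by lia.
  have := ve2 zd.
  have -> : tot =
      (count (fun p => d - (d - z) <= p) P2 + count (fun p => p <= d - z) P0).+1.
    rewrite /tot x0 y0 /= !subn0 (tail P2) //.
    rewrite (_ : d - (d - z) = z); [lia|lia].
  by rewrite mulnS x0 y0; lia.
- have yd : 0 < d - y < d by lia.
  have := ve1 yd.
  have -> : tot =
      (count (fun p => d - (d - y) <= p) P1 + count (fun p => p <= d - y) P2).+1.
    rewrite /tot x0 z0 /= !subn0 (tail P1) //.
    rewrite (_ : d - (d - y) = y); [lia|lia].
  by rewrite mulnS x0 z0; lia.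
- have -> : tot = count (fun p => z <= p <= d - y) P2.
    by rewrite /tot x0 /=; lia.
  have lt_ed : z < d - y < d by lia.
  by have := ed2 lt_ed; rewrite x0 (_ : d - (0 + y + z) = d - y - z); lia.
- have xd : 0 < d - x < d by lia.
  have := ve0 xd.
  have -> : tot =
      (count (fun p => d - (d - x) <= p) P0 + count (fun p => p <= d - x) P1).+1.
    rewrite /tot y0 z0 /= !subn0 (tail P0) //.
    rewrite (_ : d - (d - x) = x); [lia|lia].
  by rewrite mulnS y0 z0; lia.
- have -> : tot = count (fun p => x <= p <= d - z) P0.
    by rewrite /tot y0 /=; lia.
  have lt_ed : x < d - z < d by lia.
  by have := ed0 lt_ed; rewrite y0 (_ : d - (x + 0 + z) = d - z - x); lia.
- have -> : tot = count (fun p => y <= p <= d - x) P1.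
    by rewrite /tot z0 /=; lia.
  have lt_ed : y < d - x < d by lia.
  by have := ed1 lt_ed; rewrite z0 (_ : d - (x + y + 0) = d - x - y); lia.
Qed.
End Edges.

Section EvenPositions.
Variables (d x : nat).
Hypothesis xd : x.+1 < d.

(* With the step h = (d - 1) / (x + 1), the i-th point lies at distance > i h
   from the start of the edge, and at distance >= (x + 1 - i) h from its end. *)
Definition even_position (i : nat) := (i * d.-1 %/ x.+1).+1.
Definition even_positions : seq nat := [seq even_position i | i <- iota 1 x].

Lemma even_position_bounds i : (even_position i).-1 * x.+1 <= i * d.-1 < even_position i * x.+1.
Proof. by rewrite /even_position leq_trunc_div ltn_ceil. Qed.

Lemma even_position_gap i j : i <= j -> even_position i + (j - i) <= even_position j.
Proof.
move=> ij; rewrite /even_position addSn ltnS addnC -divnMDl //.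
apply: leq_div2r; rewrite -[X in _ <= X * _](subnK ij) mulnDl leq_add2r leq_mul2l.
by apply/orP; right; lia.
Qed.

Lemma size_even_positions : size even_positions = x.
Proof. by rewrite size_map size_iota. Qed.

Lemma even_positions_inner : inner_positions d even_positions.
Proof.
split.
  rewrite map_inj_in_uniq ?iota_uniq // => i j _ _ eij.
  have [ij|ji] := leqP i j; first by have := even_position_gap ij; lia.
  by have := even_position_gap (ltnW ji); lia.
move=> p /mapP[i]; rewrite mem_iota => ix ->.
have : i * d.-1 < d.-1 * x.+1 by rewrite mulnC ltn_mul2l; lia.
by rewrite /even_position -ltn_divLR //; move: (_ %/ _) => q; lia.
Qed.

(** Positions are rounded upwards, so the first point is at distance at least 2 from the start,
    whence the strict [c < k]. At the other end only [c <= k] is available, and one strict side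
    suffices at a vertex. *)
Lemma count_even_left k : 0 < k ->
  let c := count (fun p => p <= k) even_positions in c * d.-1 <= k * x.+1 /\ c < k.
Proof.
move=> k0 c; rewrite /c count_map.
have [c00|c0] := posnP (count (preim even_position (fun p => p <= k)) (iota 1 x)).
  by rewrite c00.
have [i [j [i1 jx _ pj cij]]] := count_iota_spread c0.
rewrite /= in pj; have := even_position_bounds j.
have : even_position j * x.+1 <= k * x.+1 by rewrite leq_mul2r pj orbT.
have : count (preim even_position (leq^~ k)) (iota 1 x) * d.-1 <= j * d.-1 by rewrite leq_mul2r; lia.
set cc := count _ _ in cij *; move=> h1 h2 h3; split; first by lia.
have h4 : cc * x.+1 <= cc * d.-1 by rewrite leq_mul2l; lia.
have : cc * x.+1 < k * x.+1 by lia.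
by rewrite ltn_mul2r.
Qed.

Lemma count_even_right k : k < d ->
  let c := count (fun p => d - k <= p) even_positions in c * d.-1 <= k * x.+1 /\ c <= k.
Proof.
move=> kd c; rewrite /c count_map.
have [c00|c0] := posnP (count (preim even_position (fun p => d - k <= p)) (iota 1 x)).
  by rewrite c00.
have [i [j [i1 jx pi _ cij]]] := count_iota_spread c0.
rewrite /= in pi; have := even_position_bounds i.
have : (d - k).-1 * x.+1 <= (even_position i).-1 * x.+1 by rewrite leq_mul2r; lia.
set cc := count _ _ in cij *; move=> h1 /andP[h2 _].
have h3 : cc * d.-1 + i * d.-1 <= x.+1 * d.-1 by rewrite -mulnDl leq_mul2r; lia.
have h4 : k * x.+1 + (d - k).-1 * x.+1 = d.-1 * x.+1 by rewrite -mulnDl; congr (_ * _); lia.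
have h5 : cc * d.-1 <= k * x.+1 by rewrite mulnC in h3; lia.
split=> //; have h6 : cc * x.+1 <= cc * d.-1 by rewrite leq_mul2l; lia.
by have : cc * x.+1 <= k * x.+1 by [lia]; rewrite leq_mul2r.
Qed.

Lemma count_even_window lo hi : lo < hi ->
  let c := count (fun p => lo <= p <= hi) even_positions in
  c.-1 * d.-1 < (hi - lo).+1 * x.+1 /\ c.-1 <= hi - lo.
Proof.
move=> lh c; rewrite /c count_map.
have [c00|c0] := posnP (count (preim even_position (fun p => lo <= p <= hi)) (iota 1 x)).
  by rewrite c00.
have [i [j [i1 jx /= pi pj cij]]] := count_iota_spread c0.
set cc := count _ _ in c0 cij *.
have [->|cc1] := posnP cc.-1; first by [].
have ij : i <= j by lia.
have := even_position_gap ij; have := even_position_bounds i; have := even_position_bounds j.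
have : even_position j <= hi by lia.
move=> pj' /andP[_ h1] /andP[h2 _] h3; split; last by lia.
have h4 : cc.-1 * d.-1 + i * d.-1 <= j * d.-1 by rewrite -mulnDl leq_mul2r; lia.
have h5 : even_position j * x.+1 <= (hi - lo).+1 * x.+1 + (even_position i).-1 * x.+1.
  by rewrite -mulnDl leq_mul2r; lia.
by lia.
Qed.
End EvenPositions.

(** With [k = hi - lo], a window with [g] gaps satisfies [d g = g (d - 1) + g < (k + 1) (x + 1) +
    k]. The excess [x + 1 + k] is at most [y + k <= k (y + 1)]: this is why an edge must carry fewer
    points than the other two together. *)
Lemma even_edge d x y : x.+1 < d -> x < y ->
  sparse_edge d (x + y).+2 (even_positions d x).
Proof.
move=> xd xy lo hi /andP[lh hd]; have [] := count_even_window xd lh.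
set c := count _ _; move=> h1 h2; have [c0|c0] := posnP c; first by rewrite c0 muln0 ltn_addr //; lia.
set k := hi - lo in h1 h2 *; have k0 : 0 < k by rewrite subn_gt0.
have cE : c = c.-1.+1 by lia.
rewrite cE mulnS ltn_add2l; move: c.-1 h1 h2 => g h1 h2.
have dE : d = d.-1.+1 by lia.
have h3 : d * g = g * d.-1 + g by rewrite {1}dE mulSn [d.-1 * g]mulnC addnC.
have h4 : k.+1 * x.+1 = k * x.+1 + x.+1 by rewrite mulSn addnC.
have h5 : (x + y).+2 * k = k * x.+1 + k * y.+1 by rewrite -mulnDr mulnC; congr (_ * _); lia.
have h6 : y.+1 <= k * y.+1 by rewrite leq_pmull.
have h7 : k + y <= k * y.+1 by nia.
lia.
Qed.

(** The densities of the two edges use [k (x + 1) + k (y + 1)] out of [(x + y + z + 2) k]. The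
    remaining [k z >= 2 k] exceeds the rounding loss [b + a < 2 k], strict thanks to the edge that
    starts at the vertex. *)
Lemma even_vertex d x y z : x.+1 < d -> y.+1 < d -> 1 < z ->
  sparse_vertex d (x + y + z).+2 (even_positions d x) (even_positions d y).
Proof.
move=> xd yd z1 k /andP[k0 kd].
have [] := count_even_right xd kd; have [] := count_even_left yd k0.
set a := count _ _; set b := count _ (even_positions d x) => h1 h2 h3 h4.
have dE : d = d.-1.+1 by lia.
have h5 : d * (b + a) = b * d.-1 + a * d.-1 + (b + a).
  by rewrite {1}dE mulSn [d.-1 * _]mulnC mulnDl addnC.
have h6 : (x + y + z).+2 * k = k * x.+1 + k * y.+1 + k * z by lia.
have h7 : k * 2 <= k * z by rewrite leq_mul2l z1 orbT.
lia.
Qed.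

Lemma balanced_even d x0 x1 x2 :
  (forall x, x \in [:: x0; x1; x2] -> 1 < x < d.-1) ->
  x0 < x1 + x2 -> x1 < x0 + x2 -> x2 < x0 + x1 ->
  balanced d 1 (edge_points d (even_positions d x0) (even_positions d x1) (even_positions d x2)).
Proof.
move=> hx t0 t1 t2.
have /andP[l0 r0] : 1 < x0 < d.-1 by apply: hx; rewrite !inE eqxx.
have /andP[l1 r1] : 1 < x1 < d.-1 by apply: hx; rewrite !inE eqxx orbT.
have /andP[l2 r2] : 1 < x2 < d.-1 by apply: hx; rewrite !inE eqxx !orbT.
have d0 : x0.+1 < d by lia.
have d1 : x1.+1 < d by lia.
have d2 : x2.+1 < d by lia.
apply: balanced_edges; rewrite ?size_even_positions; try exact: even_positions_inner.
- lia.
- by rewrite -addnA; apply: even_edge.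
- by rewrite (_ : x0 + x1 + x2 = x1 + (x0 + x2)); [apply: even_edge | lia].
- by rewrite (_ : x0 + x1 + x2 = x2 + (x0 + x1)); [apply: even_edge | lia].
- exact: even_vertex.
- by rewrite (_ : x0 + x1 + x2 = x1 + x2 + x0); [apply: even_vertex | lia].
- by rewrite (_ : x0 + x1 + x2 = x2 + x0 + x1); [apply: even_vertex | lia].
Qed.

(** Once the size minus one exceeds [2 d], crude counts suffice: a window of length [k] holds at
    most [k + 1] points, and a corner of side [k] at a vertex at most [2 k] besides the vertex. *)
Lemma balanced_boundary d x0 x1 x2 : x0 < d -> x1 < d -> x2 < d ->
  2 * d < (x0 + x1 + x2).+2 ->
  balanced d 1 (edge_points d (iota 1 x0) (iota 1 x1) (iota 1 x2)).
Proof.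
move=> d0 d1 d2 big; set m := (x0 + x1 + x2).+2.
have inn x : x < d -> inner_positions d (iota 1 x).
  by move=> xd; split; [exact: iota_uniq | move=> p; rewrite mem_iota; lia].
have edge x : sparse_edge d m (iota 1 x).
  move=> lo hi /andP[lh hd]; set k := hi - lo.
  have h1 : count (fun p => lo <= p <= hi) (iota 1 x) <= k.+1.
    by apply: leq_trans (count_interval _ _ (iota_uniq _ _)) _; lia.
  have h2 : d * count (fun p => lo <= p <= hi) (iota 1 x) <= d + d * k.
    by rewrite -mulnS leq_mul2l h1 orbT.
  have h3 : d * k < m * k by rewrite ltn_mul2r; lia.
  by lia.
have vertex x y : x < d -> sparse_vertex d m (iota 1 x) (iota 1 y).
  move=> xd k /andP[k0 kd].
  have h1 : count (fun p => d - k <= p) (iota 1 x) <= k.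
    rewrite (@eq_in_count _ _ (fun p => d - k <= p <= d.-1)); last first.
      by move=> p; rewrite mem_iota; lia.
    by apply: leq_trans (count_interval _ _ (iota_uniq _ _)) _; lia.
  have h2 : count (fun p => p <= k) (iota 1 y) <= k.
    rewrite (@eq_in_count _ _ (fun p => 1 <= p <= k)); last first.
      by move=> p; rewrite mem_iota; lia.
    by apply: leq_trans (count_interval _ _ (iota_uniq _ _)) _; lia.
  have h3 : d * (count (fun p => d - k <= p) (iota 1 x) + count (fun p => p <= k) (iota 1 y))
      <= d * (2 * k) by rewrite leq_mul2l; lia.
  have h4 : 2 * d * k < m * k by rewrite ltn_mul2r k0.
  by lia.
by apply: balanced_edges; rewrite ?size_iota; auto; lia.
Qed.

(* Points in the first l rows of a triangle of side k; the rows past the last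
   one contribute 0 because subtraction is truncated. *)
Definition rows_card (l k : nat) := \sum_(0 <= i < l) (k.+1 - i).

Lemma rows_cardS l k : rows_card l.+1 k = rows_card l k + (k.+1 - l).
Proof. by rewrite /rows_card big_nat_recr. Qed.

Lemma rows_card_le l l' k : l <= l' -> rows_card l k <= rows_card l' k.
Proof.
move=> ll'; rewrite -(subnKC ll'); elim: (l' - l) => [|i IH]; first by rewrite addn0.
by rewrite addnS rows_cardS; lia.
Qed.

Lemma rows_card_double l k : l <= k.+2 -> 2 * rows_card l k + l * l = l * (2 * k + 3).
Proof.
elim: l => [|l IH] lk; first by rewrite /rows_card big_geq.
by rewrite rows_cardS; have := IH (ltnW lk); nia.
Qed.

Lemma rows_card_sat l k : k < l -> rows_card l k = rows_card k.+1 k.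
Proof.
move=> kl; rewrite -(subnKC kl); elim: (l - _) => [|i IH]; first by rewrite addn0.
by rewrite addnS rows_cardS IH; lia.
Qed.

(** By the closed form, [rows_card l k / k = l - l (l - 3) / (2 k)], which does not decrease with
    [k] when [l >= 3]. *)
Lemma rows_card_slope_ge l d k : 2 < l -> l <= k -> k < d ->
  d * rows_card l k <= rows_card l d * k.
Proof.
move=> l3 lk kd; have hB := @rows_card_double l d (leq_trans lk (leqW (leqW (ltnW kd)))).
have hA := @rows_card_double l k (leqW (leqW lk)).
have [e dE] : exists e, d = k + e + 1 by exists (d - k).-1; lia.
have [f lE] : exists f, l = f + 3 by exists (l - 3); lia.
move: (rows_card l k) (rows_card l d) hA hB => A B hA hB.
have h1 : 2 * (d * A) + d * (l * l) = d * (l * (2 * k + 3)) by rewrite -hA; ring.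
have h2 : 2 * (B * k) + k * (l * l) = k * (l * (2 * d + 3)) by rewrite -hB; ring.
have h3 : k * (l * (2 * d + 3)) + d * (l * l) =
    d * (l * (2 * k + 3)) + k * (l * l) + (e + 1) * ((f + 3) * f).
  by rewrite dE lE; ring.
lia.
Qed.

Lemma rows_card_slope l d k : 2 < l -> l <= d -> 0 < k < d ->
  d * rows_card l k + 1 <= d + rows_card l d * k.
Proof.
move=> l3 ld /andP[k0 kd]; have [kl|lk] := ltnP k l; last first.
  by have := rows_card_slope_ge l3 lk kd; lia.
have hB := @rows_card_double l d (leqW (leqW ld)).
rewrite (rows_card_sat kl); have hA := @rows_card_double k.+1 k (leqW (leqnn _)).
(* Here the corner is a full triangle with [(k + 1) (k + 2) / 2] points. In the slacks [f], [g], [i]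
   of [k < l], [l <= d], [0 < k], the difference of the two sides has only nonnegative
   coefficients. *)
have [f lE] : exists f, l = k + 1 + f by exists (l - k.+1); lia.
have [g dE] : exists g, d = k + f + g + 1 by exists (d - l); lia.
have [i kE] : exists i, k = i + 1 by exists k.-1; lia.
move: (rows_card k.+1 k) (rows_card l d) hA hB => A B hA hB.
have hA' : 2 * A = (k + 1) * (k + 2) by nia.
have {}hB : 2 * B = l * (2 * d + 3 - l) by rewrite mulnBr -hB addnK.
have dl : 2 * d + 3 - l = k + f + 2 * g + 4 by lia.
rewrite dl lE in hB.
have h1 : 2 * d + (2 * B) * k = d * (2 * A) + 2 +
    ((i + 1) * ((i + 1 + f) * f + g * (i + 2 * f)) + i * (i + 2 * f + 2) + i + 2 * f).
  by rewrite hA' hB dE kE; ring.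
have h2 : d * (2 * A) = 2 * (d * A) by ring.
have h3 : (2 * B) * k = 2 * (B * k) by ring.
lia.
Qed.

Lemma rows_card_suffix z l d : z <= l -> z <= d ->
  rows_card z d + rows_card (l - z) (d - z) = rows_card l d.
Proof.
move=> zl zd; rewrite -{2}(subnKC zl); elim: (l - z) => [|j IH].
  by rewrite addn0 {2}/rows_card big_geq ?addn0.
by rewrite addnS !rows_cardS -IH; lia.
Qed.

Lemma rows_card_shift z l k :
  \sum_(0 <= i < l) (z <= i) * (k.+1 + z - i) = rows_card (l - z) k.
Proof.
elim: l => [|l IH]; first by rewrite sub0n /rows_card !big_geq.
rewrite big_nat_recr //= IH; have [zl|lz] := leqP z l.
  by rewrite subSn // rows_cardS; lia.
by rewrite mul0n addn0; congr rows_card; lia.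
Qed.

Lemma sub_in_count (T : eqType) (P Q : pred T) (s : seq T) :
  {in s, subpred P Q} -> count P s <= count Q s.
Proof.
move=> PQ; rewrite (@eq_in_count _ _ (predI P Q)); last first.
  by move=> a /PQ pq /=; case: (P a) pq => // /(_ isT) ->.
by apply: sub_count => a /andP[].
Qed.

(** * Full rows, an evenly filled row and the opposite vertex *)

Section Strips.
Variables (d l X : nat).
Hypotheses (l_gt2 : 2 < l) (Xl : X + l <= d).

(** Row [l] offers [d + 1 - l] places, more than [X] by [Xl]. So the points are distinct, and
    [l < d] as soon as there is one, which keeps them away from the vertex [(0, 0)]. *)
Definition spread_position i := i * (d.+1 - l) %/ X.
Definition strip_rows := [seq (a, d - i - a) | i <- iota 0 l, a <- iota 0 (d.+1 - i)].
Definition strip_part := [seq (p, d - l - p) | p <- [seq spread_position i | i <- iota 0 X]].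
Definition strip_points := (0, 0) :: strip_rows ++ strip_part.

Lemma size_strip : size strip_points = (rows_card l d + X).+1.
Proof.
rewrite /= size_cat size_allpairs_dep !size_map size_iota; congr (_ + _).+1.
rewrite sumnE big_map /rows_card /index_iota subn0.
by apply: eq_bigr => i _; rewrite size_iota.
Qed.

Lemma spread_bounds i : i < X ->
  spread_position i * X <= i * (d.+1 - l) < (spread_position i).+1 * X.
Proof. by move=> iX; rewrite leq_trunc_div ltn_ceil //; lia. Qed.

Lemma spread_le i : i < X -> spread_position i <= d - l.
Proof.
move=> iX; have /andP[h _] := spread_bounds iX.
have h2 : i * (d.+1 - l) < X * (d.+1 - l) by rewrite ltn_mul2r; lia.
have : spread_position i * X < (d.+1 - l) * X by rewrite [X in _ < X]mulnC; lia.
by rewrite ltn_mul2r; lia.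
Qed.

Lemma spread_ltn i j : i < j < X -> spread_position i < spread_position j.
Proof.
move=> /andP[ij jX]; have iX := ltn_trans ij jX.
have /andP[h1 _] := spread_bounds iX; have /andP[_ h2] := spread_bounds jX.
have h3 : i.+1 * (d.+1 - l) <= j * (d.+1 - l) by rewrite leq_mul2r ij orbT.
have h4 : spread_position i * X + X < (spread_position j).+1 * X by rewrite mulSn in h3; lia.
by move: h4; rewrite addnC -mulSn ltn_mul2r; lia.
Qed.

Lemma spread_gap i j : i <= j < X -> spread_position i + (j - i) <= spread_position j.
Proof.
elim: j => [|j IH] /andP[ij jX]; first by have -> : i = 0 by [lia]; rewrite subnn addn0.
move: ij; rewrite leq_eqVlt => /orP[/eqP <-|ij]; first by rewrite subnn addn0.
have := @spread_ltn j j.+1; rewrite ltnSn jX => /(_ isT) h.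
have ijX : i <= j < X by lia.
by have := IH ijX; lia.
Qed.

Lemma uniq_strip : uniq strip_points.
Proof.
have inrow p : p \in strip_rows -> exists2 i, i < l & p.1 + p.2 = d - i.
  move=> /allpairsPdep[i [a [hi ha ->]]]; rewrite !mem_iota in hi ha.
  by exists i => //=; lia.
have inpart p : p \in strip_part -> p.1 + p.2 = d - l /\ l < d.
  move=> /mapP[q /mapP[i]]; rewrite mem_iota => iX -> -> /=.
  by have := @spread_le i; lia.
rewrite /= mem_cat negb_or cat_uniq; apply/andP; split; [apply/andP; split|apply/and3P; split].
- by apply/negP => /inrow[i il /=]; lia.
- by apply/negP => /inpart /=; lia.
- apply: allpairs_uniq_dep => [|i _|]; [exact: iota_uniq | exact: iota_uniq |].
  move=> u v /allpairsPdep[i [a [hi ha ->]]] /allpairsPdep[j [b [hj hb ->]]] /= [eab ed].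
  rewrite !mem_iota in hi ha hj hb; subst b.
  by have -> : i = j by lia.
- by apply/hasPn => p /inpart[hp ld]; apply/negP => /inrow[i il]; lia.
- rewrite map_inj_uniq => [|p q [] //]; rewrite map_inj_in_uniq ?iota_uniq //.
  move=> i j; rewrite !mem_iota => iX jX eij.
  have [ij|ji|//] := ltngtP i j; first by have := @spread_ltn i j; lia.
  by have := @spread_ltn j i; lia.
Qed.

Lemma count_strip_rows x y z : x + y + z <= d ->
  count (in_corner d x y z) strip_rows <= rows_card (l - z) (d - (x + y + z)).
Proof.
move=> xyz; rewrite /strip_rows count_flatten -map_comp sumnE big_map.
rewrite -rows_card_shift /index_iota subn0 big_seq [X in _ <= X]big_seq.
apply: leq_sum => i; rewrite mem_iota add0n => /andP[_ il] /=.
rewrite count_map; have [zi|iz] := leqP z i; last first.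
  rewrite mul0n leqn0 -[_ == 0]negbK -lt0n -has_count; apply/hasPn => a.
  by rewrite mem_iota /in_corner /=; lia.
have [iy|yi] := leqP (i + y) d; last first.
  rewrite (_ : count _ _ = 0) //; apply/eqP; rewrite -[_ == 0]negbK -lt0n -has_count.
  by apply/hasPn => a; rewrite mem_iota /in_corner /=; lia.
rewrite mul1n; apply: leq_trans (_ : count (fun a => x <= a <= d - i - y) (iota 0 (d.+1 - i)) <= _).
  by apply: sub_in_count => a; rewrite mem_iota /in_corner /=; lia.
by apply: leq_trans (count_interval _ _ (iota_uniq _ _)) _; lia.
Qed.

(** Row [l] meets the corner in [k + 1 + z - l] places, and the [Y - 1] gaps between the points
    there obey the density [X / (d + 1 - l)]; strictness comes from rounding down. *)
Lemma count_strip_part x y z (k := d - (x + y + z)) (Y := count (in_corner d x y z) strip_part) :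
  x + y + z <= d -> 0 < Y ->
  [/\ Y <= X, l <= k + z, z <= l, Y <= k.+1 + z - l & Y.-1 * (d.+1 - l) < (k.+1 + z - l) * X].
Proof.
move=> xyz Y0; rewrite /Y /strip_part !count_map in Y0 *.
have YX : count (preim spread_position (preim (fun p => (p, d - l - p)) (in_corner d x y z))) (iota 0 X) <= X.
  by rewrite -[X in _ <= X](size_iota 0) count_size.
have [i [j [_ jX /= pi pj cij]]] := count_iota_spread Y0.
set c := count _ _ in YX cij Y0 *; rewrite add0n in jX.
have ij : i <= j by lia.
have iX : i < X by lia.
have := spread_le iX; have := spread_le jX; move: pi pj; rewrite /in_corner /= => pi pj qi qj.
have ijX : i <= j < X by lia.
have gap := spread_gap ijX.
have /andP[h1 _] := spread_bounds iX; have /andP[_ h2] := spread_bounds jX.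
have ww : spread_position j + y + l <= d by lia.
split=> //; try lia.
have h3 : c.-1 * (d.+1 - l) + i * (d.+1 - l) <= j * (d.+1 - l) by rewrite -mulnDl leq_mul2r; lia.
have h4 : (spread_position j).+1 * X <= (k.+1 + z - l) * X + spread_position i * X.
  by rewrite -mulnDl leq_mul2r; lia.
lia.
Qed.

Lemma balanced_strip : balanced d 1 strip_points.
Proof.
have l0 : 0 < l by lia.
split.
- exact: uniq_strip.
- move=> p; rewrite inE mem_cat => /or3P[/eqP -> //|/allpairsPdep[i [a [hi ha ->]]]|/mapP[q /mapP[i]]] /=.
    by rewrite !mem_iota in hi ha; lia.
  by rewrite mem_iota => iX -> -> /=; have := @spread_le i; lia.
- split; rewrite inE ?eqxx // mem_cat; apply/orP; right; apply/orP; left; apply/allpairsPdep.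
    by exists 0, d; split; rewrite ?mem_iota; [lia | lia | rewrite subn0 subnn].
  by exists 0, 0; split; rewrite ?mem_iota; [lia | lia | rewrite !subn0].
move=> x y z xyz; rewrite size_strip /= count_cat.
have xyz' : x + y + z <= d by lia.
have rowsE := count_strip_rows xyz'; have partE := count_strip_part xyz'.
move: (count _ strip_rows) (count _ strip_part) rowsE partE => r Y hr hY.
set k := d - (x + y + z) in hr hY *; have k0 : 0 < k < d by lia.
(* Row [d] consists of the vertex [(0, 0)], so [rows_card d d] counts all other points of the
   triangle. *)
have RX : rows_card l d + X <= rows_card d d.
  have [ld|dl] := ltnP l d; last by have -> : l = d by [lia]; lia.
  by apply: leq_trans (rows_card_le _ (ld : l.+1 <= d)); rewrite rows_cardS; lia.
(* A corner at [(0, 0)] loses exactly the first [z] rows. It suffices that [z (rows_card l d + X) <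
   d * rows_card z d], and the left side is at most [z d (d + 3) / 2] by [RX]. *)
have [xy0|xy0] := posnP (x + y).
  have [x0 y0] : x = 0 /\ y = 0 by lia.
  have -> : in_corner d x y z (0, 0) = true by rewrite /in_corner /=; lia.
  have [zl|lz] := leqP z l; last first.
    have r0 : r = 0 by move: hr; rewrite (_ : l - z = 0) /rows_card ?big_geq; lia.
    have Y0 : Y = 0 by have [//|/hY[]] := posnP Y; lia.
    have R0 : 0 < rows_card l d.
      by apply: leq_trans (rows_card_le d l0); rewrite /rows_card big_nat1.
    have : 0 < (rows_card l d + X) * k by rewrite muln_gt0 addn_gt0 R0; lia.
    by rewrite r0 Y0; lia.
  have zd : z <= d by lia.
  have kE : k = d - z by rewrite /k x0 y0.
  have YX : Y <= X by have [->|/hY[]] := posnP Y.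
  have sfx := rows_card_suffix zl zd; rewrite -kE in sfx.
  have Rd : 2 * rows_card d d = d * (d + 3).
    by have := @rows_card_double d d (leqW (leqnSn _)); lia.
  have Rz : 2 * rows_card z d + z * z = z * (2 * d + 3).
    by apply: rows_card_double; lia.
  have z0 : 0 < z by lia.
  have dE : d = z + k by lia.
  have h1 : 2 * (z * (rows_card l d + X)) <= z * (d * (d + 3)).
    by rewrite -Rd mulnCA leq_mul2l leq_mul2l RX !orbT.
  have h2 : 2 * (d * rows_card z d) + d * (z * z) = d * (z * (2 * d + 3)) by rewrite -Rz; ring.
  have h3 : z * (d * (d + 3)) + d * (z * z) + z * k * d = d * (z * (2 * d + 3)).
    by rewrite dE; ring.
  have h4 : 2 <= z * k * d.
    have zk : 0 < z * k by rewrite muln_gt0 z0; lia.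
    by apply: leq_trans (_ : 2 <= d) _; [lia | rewrite leq_pmull].
  have h5 : d * (r + Y) + d * rows_card z d <= d * (rows_card l d + X).
    by rewrite -mulnDr leq_mul2l; lia.
  have h6 : (rows_card l d + X) * k + z * (rows_card l d + X) = d * (rows_card l d + X).
    by rewrite dE; ring.
  by rewrite mulnDr muln1; lia.
have -> : in_corner d x y z (0, 0) = false by rewrite /in_corner /=; lia.
rewrite add0n; have ld : l <= d by lia.
have slope := rows_card_slope l_gt2 ld k0.
have [Y0|Y_gt0] := posnP Y.
  have : d * r <= d * rows_card l k.
    rewrite leq_mul2l; apply/orP; right; apply: leq_trans hr _.
    by apply: rows_card_le; lia.
  by rewrite Y0 addn0 mulnDl; lia.
have [YX lkz zl Yk Ygap] := hY Y_gt0.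
(* For [z > 0] row 0 misses the corner, so the partial row may be counted as a full one in its
   place. *)
have [z0|z_gt0] := posnP z; last first.
  have : d * (r + Y) <= d * rows_card l k.
    rewrite leq_mul2l; apply/orP; right.
    apply: leq_trans (rows_card_le k (_ : (l - z).+1 <= l)); last by lia.
    by rewrite rows_cardS; lia.
  by rewrite mulnDl; lia.
(* For [z = 0], [lkz] says [l <= k], so the full rows satisfy the slope inequality without the extra
   [d], which remains available for the partial row. *)
rewrite z0 subn0 addn0 in hr lkz Yk Ygap.
have /andP[_ kd] := k0.
have slope' := rows_card_slope_ge l_gt2 lkz kd.
have h1 : d * r <= d * rows_card l k by rewrite leq_mul2l hr orbT.
have YE : d * Y = d + (Y.-1 * (d.+1 - l) + Y.-1 * (l - 1)).
  rewrite -mulnDr (_ : d.+1 - l + (l - 1) = d); last lia.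
  by rewrite -[in LHS](prednK Y_gt0) mulnS [d * _]mulnC.
have h2 : Y.-1 * (l - 1) <= X * (l - 1) by rewrite leq_mul2r; lia.
have h3 : X * k = (k.+1 - l) * X + X * (l - 1).
  by rewrite [_ * X]mulnC -mulnDr; congr (_ * _); lia.
by rewrite mulnDr mulnDl; lia.
Qed.
End Strips.

(** Rows are dropped until the rest fits in the next row. A rest that fills row [L] exactly becomes
    one more full row with [X = 0], since [X + l <= d] forbids a full partial row. *)
Lemma strip_exists d N : 2 < d -> 3 * d <= N <= rows_card d d ->
  exists l X, [/\ 2 < l, X + l <= d & rows_card l d + X = N].
Proof.
move=> d3 /andP[le_N]; have R3 : rows_card 3 d = 3 * d.
  by have := @rows_card_double 3 d (leqW (leqW d3)); lia.
suff gen L : 2 < L <= d -> N <= rows_card L d ->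
    exists l X, [/\ 2 < l, X + l <= d & rows_card l d + X = N].
  by apply: gen; rewrite d3 leqnn.
elim: L => // L IH /andP[L3 Ld] NL.
have [L2|{}L3] : L = 2 \/ 2 < L by lia.
  by exists 3, 0; move: NL; rewrite L2 R3; split=> //; lia.
have [NL'|NL'] := leqP N (rows_card L d); first by apply: IH => //; rewrite L3 ltnW.
rewrite rows_cardS in NL; have [eqN|neN] := eqVneq N (rows_card L.+1 d).
  by exists L.+1, 0; split=> //; rewrite ?eqN //; lia.
rewrite rows_cardS in neN.
by exists L, (N - rows_card L d); split=> //; lia.
Qed.

(** For a list of fixed length [(size s).-1] is a numeral, so linear arithmetic decides each case;
    corners with at most one point are harmless. *)
Lemma balanced_intro d s : 1 < size s -> uniq s -> {in s, forall p, p.1 + p.2 <= d} ->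
  [/\ (d, 0) \in s, (0, d) \in s & (0, 0) \in s] ->
  (forall x y z, 0 < x + y + z < d -> let c := count (in_corner d x y z) s in
     c <= 1 \/ c.-1 * d < (size s).-1 * (d - (x + y + z))) ->
  balanced d 1 s.
Proof.
move=> s1 us hs vs h; split=> // x y z xyz; have B0 : 0 < (size s).-1 * (d - (x + y + z)) by rewrite muln_gt0; lia.
have := h x y z xyz; move: (count _ _) ((size s).-1 * _) B0 => c B B0 /= [c1|c2].
  have h1 : d * c <= d * 1 by rewrite leq_mul2l c1 orbT.
  by lia.
have [c0|c0] := posnP c; first by rewrite c0 muln0; lia.
rewrite -(prednK c0) mulnS mulnC; lia.
Qed.

Lemma balanced3 d : 0 < d -> balanced d 1 [:: (d, 0); (0, d); (0, 0)].
Proof.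
move=> d0; apply: balanced_intro => //.
- by rewrite /= !inE !xpair_eqE; lia.
- by move=> p; rewrite !inE => /or3P[] /eqP -> /=; lia.
- by rewrite !inE !eqxx !orbT.
- by move=> x y z xyz /=; rewrite /in_corner /=; left; lia.
Qed.

(** The fourth point is the centroid: its exponents are [(d + 2) / 3], [(d + 1) / 3] and [d / 3],
    rounded down, which add up to [d]. *)
Lemma balanced4 d : 1 < d ->
  balanced d 1 [:: (d, 0); (0, d); (0, 0); ((d + 2) %/ 3, (d + 1) %/ 3)].
Proof.
move=> d0; apply: balanced_intro => //.
- by rewrite /= !inE !xpair_eqE; lia.
- by move=> p; rewrite !inE => /or4P[] /eqP -> /=; lia.
- by rewrite !inE !eqxx !orbT.
- by move=> x y z xyz /=; rewrite /in_corner /=; lia.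
Qed.

(** Two midpoints of edges would fail for even [d]: with their common vertex they lie in a corner of
    side [d / 2], and [2 d < 4 (d / 2)] is false. So the second point is moved one step off the edge
    [x = 0]. *)
Lemma balanced5 d : 2 < d ->
  balanced d 1 [:: (d, 0); (0, d); (0, 0); ((d + 1) %/ 2, d %/ 2); (1, (d - 1) %/ 2)].
Proof.
move=> d0; apply: balanced_intro => //.
- by rewrite /= !inE !xpair_eqE; lia.
- by move=> p; rewrite !inE => /or4P[| | |/orP[]] /eqP -> /=; lia.
- by rewrite !inE !eqxx !orbT.
- by move=> x y z xyz /=; rewrite /in_corner /=; lia.
Qed.

Lemma inner_positions1 d p : 0 < p < d -> inner_positions d [:: p].
Proof. by move=> pd; split=> // q; rewrite inE => /eqP ->. Qed.

Lemma inner_positions2 d p q : 0 < p < q -> q < d -> inner_positions d [:: p; q].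
Proof.
move=> pq qd; split=> [|r]; first by rewrite /= inE; lia.
by rewrite !inE => /orP[] /eqP ->; lia.
Qed.

Lemma leq_mul_count d c b B : c <= b -> d * b < B -> d * c < B.
Proof. by move=> cb; apply: leq_ltn_trans; rewrite leq_mul2l cb orbT. Qed.

Lemma sparse_edge1 d m p : 0 < m -> sparse_edge d m [:: p].
Proof.
move=> m0 lo hi lh; apply: (@leq_mul_count _ _ 1); first by rewrite /=; lia.
by have : 0 < m * (hi - lo); [rewrite muln_gt0; lia | lia].
Qed.

Lemma sparse_edge2 d m p q : p < q -> d < m * (q - p) -> sparse_edge d m [:: p; q].
Proof.
move=> pq dm lo hi lh; have [h|h] := boolP ((lo <= p) && (q <= hi)).
  apply: (@leq_mul_count _ _ 2); first by rewrite /=; lia.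
  have : m * (q - p) <= m * (hi - lo) by rewrite leq_mul2l; lia.
  by lia.
apply: (@leq_mul_count _ _ 1); first by rewrite /=; lia.
by have : 0 < m * (hi - lo); [rewrite muln_gt0; lia | lia].
Qed.

Lemma sparse_vertex_intro d m P Q :
  (forall k, 0 < k < d ->
    (count (fun p => d - k <= p) P + count (fun p => p <= k) Q) * d < m * k) ->
  sparse_vertex d m P Q.
Proof. by move=> h k /h; rewrite mulnC. Qed.

Lemma balanced6 d : 2 < d ->
  balanced d 1 (edge_points d [:: d %/ 2] [:: d %/ 2] [:: d %/ 2]).
Proof.
move=> d0; have in1 : inner_positions d [:: d %/ 2] by apply: inner_positions1; lia.
apply: balanced_edges => //; try by apply: sparse_edge1.
- by lia.
- by apply: sparse_vertex_intro => k kd /=; lia.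
- by apply: sparse_vertex_intro => k kd /=; lia.
- by apply: sparse_vertex_intro => k kd /=; lia.
Qed.

(** For [d = 3] and [d = 4] these positions give equality at a vertex, [3 * 2 = 6 * 1] and
    [4 * 3 = 6 * 2]; those degrees get families of their own. *)
Lemma balanced7 d : 4 < d -> let p := (d - 1) %/ 2 + 1 in
  balanced d 1 (edge_points d [:: p] [:: p] [:: (d - 1) %/ 3 + 1; 2 * (d - 1) %/ 3 + 1]).
Proof.
move=> d0 p; have in1 : inner_positions d [:: p] by apply: inner_positions1; rewrite /p; lia.
apply: balanced_edges => //; try by apply: sparse_edge1.
- by lia.
- by apply: inner_positions2; lia.
- by apply: sparse_edge2; rewrite /=; lia.
- by apply: sparse_vertex_intro => k kd /=; rewrite /p; lia.
- by apply: sparse_vertex_intro => k kd /=; rewrite /p; lia.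
- by apply: sparse_vertex_intro => k kd /=; rewrite /p; lia.
Qed.

Lemma balanced8 d : 3 < d -> let p := (d - 1) %/ 3 + 1 in let q := 2 * (d - 1) %/ 3 + 1 in
  balanced d 1 (edge_points d [:: p; q] [:: p; q] [:: (d - 1) %/ 2 + 1]).
Proof.
move=> d0 p q; have in2 : inner_positions d [:: p; q].
  by apply: inner_positions2; rewrite /p /q; lia.
apply: balanced_edges => //; try by apply: sparse_edge1.
- by lia.
- by apply: inner_positions1; lia.
- by apply: sparse_edge2; rewrite /p /q /=; lia.
- by apply: sparse_edge2; rewrite /p /q /=; lia.
- by apply: sparse_vertex_intro => k kd /=; rewrite /p /q; lia.
- by apply: sparse_vertex_intro => k kd /=; rewrite /p /q; lia.
- by apply: sparse_vertex_intro => k kd /=; rewrite /p /q; lia.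
Qed.

(** [X_0] divides three of the five monomials, and [2 * 3 = 2 + 4 * 1] leaves no slack. This is
    unavoidable: next to the three squares, any two mixed monomials share a variable. *)
Lemma balanced2_5 : balanced 2 0 [:: (2, 0); (0, 2); (0, 0); (1, 1); (1, 0)].
Proof.
split=> //; last by move=> x y z xyz /=; rewrite /in_corner /=; lia.
by move=> p; rewrite !inE => /or4P[| | |/orP[]] /eqP ->.
Qed.

Lemma balanced3_7 :
  balanced 3 1 [:: (3, 0); (0, 3); (0, 0); (2, 1); (0, 2); (1, 0); (1, 1)].
Proof.
split=> //; last by move=> x y z xyz /=; rewrite /in_corner /=; lia.
by move=> p; rewrite !inE => /or4P[| | |/or4P[]] /eqP ->.
Qed.

Lemma balanced4_7 :
  balanced 4 1 [:: (4, 0); (0, 4); (0, 0); (3, 1); (0, 3); (1, 0); (2, 1)].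
Proof.
split=> //; last by move=> x y z xyz /=; rewrite /in_corner /=; lia.
by move=> p; rewrite !inE => /or4P[| | |/or4P[]] /eqP ->.
Qed.

(** Even spacing requires at least two points inside each edge, hence [n >= 9], and at most [d - 2],
    ensured by [n <= 2 d + 1]; smaller families are placed by hand. *)
Lemma exists_balanced d n : 0 < d -> 3 <= n <= 'C(d + 2, 2) -> (d, n) <> (2, 5) ->
  exists2 s, size s = n & balanced d 1 s.
Proof.
move=> d0 /andP[n3 nC] dn.
have Rd : rows_card d d + 1 = 'C(d + 2, 2).
  have h1 := @rows_card_double d d (leqW (leqnSn _)).
  by have := mul_bin_diag d.+2 1; rewrite bin1 addn2 /=; lia.
have [n_strip|n_big] := ltnP (3 * d) n.
  have d3 : 2 < d.
    by case: d d0 Rd nC n_strip {dn} => [|[|[|d]]] // _ _; rewrite /binomial /=; lia.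
  have [|l [X [l3 Xl eqn]]] := @strip_exists d n.-1 d3; first by lia.
  by exists (strip_points d l X); [rewrite size_strip eqn; lia | apply: balanced_strip].
have [n_bd|n_small] := ltnP (2 * d).+1 n.
  pose x0 := minn (n - 3) d.-1; pose x1 := minn (n - 3 - x0) d.-1.
  exists (edge_points d (iota 1 x0) (iota 1 x1) (iota 1 (n - 3 - x0 - x1))).
    by rewrite size_edge_points !size_iota /x1 /x0; lia.
  by apply: balanced_boundary; rewrite /x1 /x0; lia.
have [n9|n9] := ltnP 8 n.
  pose X := n - 3.
  exists (edge_points d (even_positions d (X %/ 3)) (even_positions d ((X + 1) %/ 3))
     (even_positions d ((X + 2) %/ 3))).
    by rewrite size_edge_points !size_even_positions /X; lia.
  apply: balanced_even; rewrite /X; try lia.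
  by move=> x; rewrite !inE => /or3P[] /eqP ->; lia.
have [->|n_3] := eqVneq n 3; first by eexists; last exact: balanced3.
have [->|n_4] := eqVneq n 4; first by eexists; last by apply: balanced4; lia.
have [n5|n_5] := eqVneq n 5.
  have d3 : 2 < d by rewrite n5 in dn n_small; have : d <> 2 by [move=> d2; apply: dn; rewrite d2]; lia.
  by rewrite n5; eexists; last exact: balanced5.
have [->|n_6] := eqVneq n 6; first by eexists; last by apply: balanced6; lia.
have [n7|n_7] := eqVneq n 7.
  rewrite n7; have [d3|[d4|d5]] : d = 3 \/ d = 4 \/ 4 < d by lia.
  - by rewrite d3; eexists; last exact: balanced3_7.
  - by rewrite d4; eexists; last exact: balanced4_7.
  - by eexists; last exact: balanced7.
have -> : n = 8 by lia.
by eexists; last by apply: balanced8; lia.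
Qed.

Import Order.TTheory GRing.Theory Num.Theory.
Local Open Scope ring_scope.

(** * Sections of the line bundles on the projective plane *)

Section Evaluation.
Variable K : closedFieldType.
Implicit Types (p q : {mpoly K[3]}) (x : 'rV[K]_3).

Lemma evD x : {morph (fun p => ev p x) : p q / p + q}.
Proof. exact: mevalD. Qed.
Lemma evB x : {morph (fun p => ev p x) : p q / p - q}.
Proof. exact: mevalB. Qed.
Lemma evM x : {morph (fun p => ev p x) : p q / p * q}.
Proof. exact: mevalM. Qed.
Lemma ev0 x : ev 0 x = 0.
Proof. exact: meval0. Qed.
Lemma ev1 x : ev 1 x = 1.
Proof. exact: meval1. Qed.
Lemma evZ c p x : ev (c *: p) x = c * ev p x.
Proof. exact: mevalZ. Qed.
Lemma evXU i x : ev 'X_i x = x 0 i.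
Proof. exact: mevalXU. Qed.
Lemma evXn p k x : ev (p ^+ k) x = ev p x ^+ k.
Proof. exact: (rmorphXn (meval (fun i => x 0 i))). Qed.
Lemma ev_sum (I : Type) (r : seq I) (P : pred I) (F : I -> {mpoly K[3]}) x :
  ev (\sum_(i <- r | P i) F i) x = \sum_(i <- r | P i) ev (F i) x.
Proof. exact: (raddf_sum (meval (fun i => x 0 i))). Qed.

Lemma base_digits_inj (B a b c a' b' c' : nat) :
  (a < B)%N -> (b < B)%N -> (a' < B)%N -> (b' < B)%N ->
  (a + b * B + c * (B * B) = a' + b' * B + c' * (B * B))%N ->
  [/\ a = a', b = b' & c = c'].
Proof.
move=> ha hb ha' hb' h.
have split a0 b0 c0 : (a0 + b0 * B + c0 * (B * B) = (b0 + c0 * B) * B + a0)%N.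
  by rewrite mulnDl -mulnA; lia.
have B0 : (0 < B)%N by lia.
have eqa : a = a'.
  move/(congr1 (modn^~ B)): h.
  by rewrite !split !modnMDl !modn_small.
subst a'; have eqbc : (c * B + b = c' * B + b')%N.
  move/(congr1 (divn^~ B)): h.
  by rewrite !split !divnMDl // divn_small // !addn0 ![(_ + c * B)%N]addnC ![(_ + c' * B)%N]addnC.
have eqb : b = b' by move/(congr1 (modn^~ B)): eqbc; rewrite !modnMDl !modn_small.
subst b'; split=> //; move/addIn/eqP: eqbc; rewrite eqn_pmul2r //.
by move/eqP.
Qed.

(** Kronecker substitution: [X_i] becomes [t ^ (B ^ i)] with [B] larger than all exponents, so
    distinct monomials get distinct degrees and a nonzero polynomial in [t] results; it has a
    non-root. *)
Lemma ev_neq0 p : p != 0 -> exists x, ev p x != 0.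
Proof.
move=> p0; set B := msize p.
pose w (m : 'X_{1..3}) := (\sum_(i < 3) B ^ i * m i)%N.
pose f : {poly K} := \sum_(m <- msupp p) p@_m *: 'X^(w m).
have lt_deg m : m \in msupp p -> forall i, (m i < B)%N.
  move=> /msize_mdeg_lt lt_m i; apply: leq_ltn_trans lt_m.
  by rewrite mdegE (bigD1 i) //= leq_addr.
have w_inj : {in msupp p &, injective w}.
  move=> m m' hm hm'; rewrite /w !big_ord_recl !big_ord0 /= => h.
  have [] := @base_digits_inj B (m 0) (m (lift ord0 0)) (m (lift ord0 (lift ord0 0)))
     (m' 0) (m' (lift ord0 0)) (m' (lift ord0 (lift ord0 0))); rewrite ?lt_deg //.
    move: h; rewrite /bump /= !addn0 !expn0 !expn1 !mul1n expnS expn1.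
    by rewrite ![(B * m _)%N]mulnC ![(B * m' _)%N]mulnC ![(B * B * m _)%N]mulnC ![(B * B * m' _)%N]mulnC !addnA.
  move=> e0 e1 e2; apply/mnmP=> i.
  by case: i => [[|[|[|i]]] hi] //; [move: e0 | move: e1 | move: e2];
     congr (m _ = m' _); apply: val_inj.
have f0 : f != 0.
  apply/eqP => /(congr1 (fun g : {poly K} => g`_(w (mlead p)))).
  rewrite coef0 coef_sum (bigD1_seq (mlead p)) ?msupp_uniq ?mlead_supp //=.
  rewrite coefZ coefXn eqxx mulr1 big_seq_cond big1 ?addr0.
    by apply/eqP; rewrite mleadc_eq0.
  move=> m /andP[hm ne]; rewrite coefZ coefXn.
  case: eqP => [e|]; last by rewrite mulr0.
  by move: ne; rewrite (w_inj _ _ _ _ (esym e)) ?mlead_supp ?eqxx.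
have /closed_nonrootP[t] := f0; rewrite rootE => ft.
exists (\row_i t ^+ (B ^ i)); apply: contra_neq ft => <-.
rewrite /f horner_sum /ev mevalE; apply: eq_bigr => m _.
rewrite hornerZ hornerXn; congr (_ * _); rewrite /w -prodrXr.
by apply: eq_bigr => i _; rewrite mxE exprM.
Qed.

Lemma mpoly_ev_inj p q : (forall x, x != 0 -> ev p x = ev q x) -> p = q.
Proof.
move=> eq_pq; apply/eqP; rewrite -subr_eq0; apply: contraT => ne.
(* The factor [X_0] takes care of the origin, the only point outside the hypothesis. *)
have X0 : 'X_ord0 != 0 :> {mpoly K[3]}.
  by rewrite -msize_poly_eq0 msizeX.
have /ev_neq0[x] : 'X_ord0 * (p - q) != 0 by rewrite mulf_neq0.
rewrite evM evB evXU; have [->|x0] := eqVneq x 0; first by rewrite mxE mul0r eqxx.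
by rewrite (eq_pq x x0) subrr mulr0 eqxx.
Qed.

Lemma coord_neq0 x : x != 0 -> exists j, x 0 j != 0.
Proof.
move=> x0; apply/existsP; apply: contraNT x0; rewrite negb_exists => /forallP h.
by apply/eqP/rowP => j; rewrite mxE; apply/eqP; move: (h j); rewrite negbK.
Qed.
End Evaluation.

(** * Zariski open sets: density and irreducibility *)

Section Opens.
Variable K : closedFieldType.
Implicit Types (p q : {mpoly K[3]}) (x : 'rV[K]_3) (U V W : region K).

Lemma zopen_neq0 U x : zopen U -> U x -> x != 0.
Proof. by move=> [B _ hB] /hB[]. Qed.

Definition Dopen q : region K := fun x => x != 0 /\ ev q x != 0.

Lemma zopen_D q k : q \is k.-homog -> zopen (Dopen q).
Proof.
move=> hq; exists (fun p => p = q) => [p ->|x]; first by exists k.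
split=> [[x0 qx]|[x0 [p -> qx]]]; first by split=> //; exists q.
by split.
Qed.

Lemma zopen_P2 : zopen (@P2 K).
Proof.
exists (fun p => p = 1) => [p ->|x]; first by exists 0%N; rewrite dhomog1.
split=> [x0|[]] //; split=> //; exists 1 => //.
by rewrite ev1 oner_eq0.
Qed.

Lemma zopenI U V : zopen U -> zopen V -> zopen (fun x => U x /\ V x).
Proof.
move=> [B hB BU] [C hC CV].
exists (fun p => exists b c, [/\ B b, C c & p = b * c]).
  move=> p [b [c [/hB[k hb] /hC[l hc] ->]]].
  by exists (k + l)%N; rewrite dhomogM.
move=> x; split=> [[/BU[x0 [b Bb bx]] /CV[_ [c Cc cx]]]|].
  split=> //; exists (b * c); first by exists b, c.
  by rewrite evM mulf_neq0.
move=> [x0 [_ [b [c [Bb Cc ->]]]]]; rewrite evM mulf_eq0 negb_or.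
by move=> /andP[bx cx]; split; [apply/BU | apply/CV]; split=> //; [exists b | exists c].
Qed.

Lemma zopen_basic U x : zopen U -> U x ->
  exists b k, [/\ b \is k.-homog, ev b x != 0 & subregion (Dopen b) U].
Proof.
move=> [B hB BU] /[dup] Ux /BU[x0 [b Bb bx]]; have [k hb] := hB _ Bb.
by exists b, k; split=> // y [y0 yb]; apply/BU; split=> //; exists b.
Qed.

Lemma zopen_dense U p q : zopen U -> (exists x, U x) ->
  (forall x, U x -> ev p x = ev q x) -> p = q.
Proof.
move=> oU [x Ux] eq_pq; have [b [k [hb bx bU]]] := zopen_basic oU Ux.
have b0 : b != 0 by apply: contraNneq bx => ->; rewrite ev0.
apply: (mulfI b0); apply: mpoly_ev_inj => y y0; rewrite !evM.
have [->|by0] := eqVneq (ev b y) 0; first by rewrite !mul0r.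
by rewrite eq_pq //; apply: bU.
Qed.

Lemma zopen_meet U V : zopen U -> zopen V -> (exists x, U x) ->
  (exists x, V x) -> exists x, U x /\ V x.
Proof.
move=> oU oV [x Ux] [y Vy].
have [b [k [hb bx bU]]] := zopen_basic oU Ux.
have [c [l [hc cy cV]]] := zopen_basic oV Vy.
have b0 : b != 0 by apply: contraNneq bx => ->; rewrite ev0.
have c0 : c != 0 by apply: contraNneq cy => ->; rewrite ev0.
have /ev_neq0[z] : 'X_ord0 * (b * c) != 0.
  by rewrite !mulf_neq0 // -msize_poly_eq0 msizeX.
rewrite !evM evXU !mulf_eq0 !negb_or => /and3P[z0 bz cz].
have nz : z != 0 by apply: contraNneq z0 => ->; rewrite mxE.
by exists z; split; [apply: bU | apply: cV].
Qed.
End Opens.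

Section StructureSheaf.
Variable K : closedFieldType.
Implicit Types (p q : {mpoly K[3]}) (x : 'rV[K]_3) (U V W : region K) (e : int).

Lemma dhomogXUn (j : 'I_3) l : ('X_j ^+ l : {mpoly K[3]}) \is l.-homog.
Proof.
have hj : ('X_j : {mpoly K[3]}) \is 1.-homog by rewrite dhomogX; apply/eqP; exact: mdeg1.
by have := dhomogMn l hj; rewrite mul1n.
Qed.

Lemma section_O_frac e U p q k l : p \is k.-homog -> q \is l.-homog ->
  k%:Z - l%:Z = e -> zopen U -> (forall x, U x -> ev q x != 0) ->
  section_O e U (fun x => ev p x / ev q x).
Proof.
move=> hp hq kl oU qU x Ux; exists U, p, q, k, l.
by split; split=> // y Uy; split=> //; apply: qU.
Qed.

Lemma section_O_poly k U p : p \is k.-homog -> zopen U ->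
  section_O k%:Z U (ev p).
Proof.
move=> hp oU x Ux; exists U, p, 1, k, 0%N.
split; split=> //; first exact: dhomog1.
  by rewrite subr0.
by move=> y Uy; rewrite ev1 divr1 oner_eq0.
Qed.

Lemma section_O_restr e U W s t : section_O e U s -> zopen W ->
  subregion W U -> (forall x, W x -> t x = s x) -> section_O e W t.
Proof.
move=> sU oW WU ts x Wx; have [V [p [q [k [l [[oV VU Vx] [hp hq kl sV]]]]]]] := sU x (WU x Wx).
exists (fun y => V y /\ W y), p, q, k, l; split; split=> //.
- exact: zopenI.
- by move=> y [].
- by move=> y [Vy Wy]; have [qy sy] := sV y Vy; rewrite ts.
Qed.

Lemma section_O_local e U s : zopen U ->
  (forall x, U x -> exists V, [/\ zopen V, subregion V U, V x & section_O e V s]) ->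
  section_O e U s.
Proof.
move=> oU h x Ux; have [V [oV VU Vx sV]] := h x Ux.
have [W [p [q [k [l [[oW WV Wx] D]]]]]] := sV x Vx.
by exists W, p, q, k, l; split=> //; split=> // y /WV/VU.
Qed.

Lemma section_OD e U s t : section_O e U s -> section_O e U t ->
  section_O e U (fun x => s x + t x).
Proof.
move=> sU tU x Ux.
have [V [p [q [k [l [[oV VU Vx] [hp hq kl sV]]]]]]] := sU x Ux.
have [W [p' [q' [k' [l' [[oW WU Wx] [hp' hq' kl' tW]]]]]]] := tU x Ux.
exists (fun y => V y /\ W y), (p * q' + p' * q), (q * q'), (k + l')%N, (l + l')%N.
split; split.
- exact: zopenI.
- by move=> y [/VU].
- by [].
- apply: rpredD; first exact: dhomogM.
  have -> : (k + l' = k' + l)%N by lia.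
  exact: dhomogM.
- exact: dhomogM.
- lia.
- move=> y [/sV[qy ->] /tW[q'y ->]]; rewrite evD !evM mulf_neq0 //; split=> //.
  by field; rewrite ?qy ?q'y.
Qed.

Lemma section_OM e e' U s t : section_O e U s -> section_O e' U t ->
  section_O (e + e') U (fun x => s x * t x).
Proof.
move=> sU tU x Ux.
have [V [p [q [k [l [[oV VU Vx] [hp hq kl sV]]]]]]] := sU x Ux.
have [W [p' [q' [k' [l' [[oW WU Wx] [hp' hq' kl' tW]]]]]]] := tU x Ux.
exists (fun y => V y /\ W y), (p * p'), (q * q'), (k + k')%N, (l + l')%N.
split; split.
- exact: zopenI.
- by move=> y [/VU].
- by [].
- exact: dhomogM.
- exact: dhomogM.
- lia.
- move=> y [/sV[qy ->] /tW[q'y ->]]; rewrite !evM mulf_neq0 //; split=> //.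
  by field; rewrite ?qy ?q'y.
Qed.

Lemma section_O0 e U : zopen U -> section_O e U (fun=> 0).
Proof.
move=> oU x Ux; have x0 := zopen_neq0 oU Ux.
have [j xj] := coord_neq0 x0.
have [k [l kl]] : exists k l : nat, k%:Z - l%:Z = e.
  by case: e => n; [exists n, 0%N | exists 0%N, n.+1]; lia.
have hX : 'X_j ^+ l \is [in K[3], l.-homog] by exact: dhomogXUn.
exists (fun y => U y /\ Dopen ('X_j ^+ l) y), 0, ('X_j ^+ l), k, l.
split; split=> //.
- by apply: zopenI => //; apply: zopen_D hX.
- by move=> y [].
- by split=> //; split=> //; rewrite evXn evXU expf_neq0.
- exact: dhomog0.
- by move=> y [_ [_ yj]]; rewrite ev0 mul0r.
Qed.

Lemma section_O_sum e U (I : Type) (r : seq I) (s : I -> 'rV[K]_3 -> K) :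
  zopen U -> (forall i, section_O e U (s i)) ->
  section_O e U (fun x => \sum_(i <- r) s i x).
Proof.
move=> oU sU; elim: r => [|i r IH].
  by apply: section_O_restr (section_O0 e oU) oU _ _ => // x _; rewrite big_nil.
by apply: section_O_restr (section_OD (sU i) IH) oU _ _ => // x _; rewrite big_cons.
Qed.

(* Two presentations of the same section as a fraction cross-multiply, since
   nonempty opens are dense. *)
Lemma frac_unique U V s p q p' q' : zopen U -> zopen V ->
  (exists x, U x) -> (exists x, V x) ->
  (forall x, U x -> ev q x != 0 /\ s x = ev p x / ev q x) ->
  (forall x, V x -> ev q' x != 0 /\ s x = ev p' x / ev q' x) ->
  p * q' = p' * q.
Proof.
move=> oU oV Un Vn sU sV; apply: (zopen_dense (zopenI oU oV)).
  exact: zopen_meet.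
move=> x [/sU[qx sx] /sV[q'x sx']]; move: sx; rewrite {}sx' !evM.
by move/eqP; rewrite eqr_div // => /eqP ->; rewrite mulrC.
Qed.

(** A root of the denominator of [p / q] in lowest terms would be a root of every [q'] with
    [p' / q' = p / q]; as [K] is algebraically closed, that denominator is constant. *)
Lemma poly_dvd_local (p q : {poly K}) : q != 0 ->
  (forall t, exists p' q' : {poly K}, q'.[t] != 0 /\ p' * q = p * q') ->
  (q %| p)%R.
Proof.
move=> q0 h; set g := gcdp p q.
have g0 : g != 0 by rewrite gcdp_eq0 negb_and q0 orbT.
have cop : coprimep (q %/ g) (p %/ g).
  by rewrite coprimep_sym coprimep_div_gcd // q0 orbT.
have pE : p = p %/ g * g by rewrite divpK ?dvdp_gcdl.
have qE : q = q %/ g * g by rewrite divpK ?dvdp_gcdr.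
have [/size_poly1P[c c0 bc]|sb] := boolP (size (q %/ g) == 1%N).
  by rewrite qE bc mul_polyC dvdpZl // dvdp_gcdl.
have /closed_rootP[t bt] := sb.
have [p' [q' [q't pq]]] := h t.
have : p' * (q %/ g) = p %/ g * q'.
  by apply: (mulIf g0); rewrite -mulrA -qE pq mulrAC -pE.
move/(congr1 (horner^~ t)); rewrite !hornerM (rootP bt) mulr0 => /esym/eqP.
by rewrite mulf_eq0 (negPf q't) orbF (negPf (coprimep_root cop bt)).
Qed.
End StructureSheaf.

(** * Global sections of the line bundles are forms *)

Section GlobalSections.
Variable K : closedFieldType.
Implicit Types (p q : {mpoly K[3]}) (x v : 'rV[K]_3) (U V W : region K) (e : int).

Definition top_coef (R : nzRingType) (k : nat) (a : R) (F : {poly R}) :=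
  (size F <= k.+1)%N /\ F`_k = a.

Lemma top_coefM (R : comNzRingType) k l (a b : R) F G :
  top_coef k a F -> top_coef l b G -> top_coef (k + l) (a * b) (F * G).
Proof.
move=> [sF <-] [sG <-]; split.
  by apply: leq_trans (size_polyMleq _ _) _; lia.
rewrite coefM (bigD1 (inord k)) //= inordK; last by lia.
rewrite addKn big1 ?addr0 // => i ne.
have ik : (i : nat) != k by apply: contraNneq ne => ik; apply/eqP/val_inj; rewrite /= inordK //; lia.
have [lt|le] := ltnP i k.
  by rewrite (nth_default 0 (s := G)) ?mulr0 //; apply: leq_trans sG _; lia.
by rewrite (nth_default 0 (s := F)) ?mul0r //; apply: leq_trans sF _; lia.
Qed.

Lemma top_coefX (R : comNzRingType) k (a : R) F n :
  top_coef k a F -> top_coef (k * n) (a ^+ n) (F ^+ n).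
Proof.
move=> h; elim: n => [|n IH].
  by rewrite muln0 !expr0; split; rewrite ?size_poly1 ?coef1.
by rewrite mulnS !exprS; apply: top_coefM.
Qed.

(* [line_poly v p] is p(X + T v), seen as a polynomial in T. *)
Definition line_poly v p : {poly {mpoly K[3]}} :=
  mmap (polyC \o @mpolyC 3 K) (fun i => ('X_i)%:P + (v 0 i)%:MP%:P * 'X) p.

Lemma line_polyM v : {morph line_poly v : p q / p * q}.
Proof. exact: rmorphM. Qed.

Definition at_pt x (F : {poly {mpoly K[3]}}) : {poly K} :=
  map_poly (meval (fun i => x 0 i)) F.

Lemma at_ptM x : {morph at_pt x : F G / F * G}.
Proof. exact: rmorphM. Qed.

Lemma at_ptD x : {morph at_pt x : F G / F + G}.
Proof. exact: rmorphD. Qed.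

Lemma at_ptE v p x t : (at_pt x (line_poly v p)).[t] = ev p (x + t *: v).
Proof.
rewrite /at_pt /line_poly /mmap rmorph_sum horner_sum /ev mevalE.
apply: eq_bigr => m _; rewrite rmorphM hornerM /= map_polyC hornerC /= mevalC.
congr (_ * _); rewrite /mmap1 rmorph_prod horner_prod.
apply: eq_bigr => i _; rewrite rmorphXn horner_exp; congr (_ ^+ _).
by rewrite rmorphD rmorphM /= !map_polyC map_polyX !hornerE /= mevalXU mevalC !mxE mulrC.
Qed.

Lemma line_poly_at0 v p : (line_poly v p).[0] = p.
Proof.
apply: mpoly_ev_inj => x _; have <- : (at_pt x (line_poly v p)).[0] = ev p x.
  by rewrite at_ptE scale0r addr0.
have := horner_map (meval (fun i => x 0 i)) (line_poly v p) 0.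
by rewrite rmorph0 => h; apply: (esym h).
Qed.

Lemma line_poly_top v p k : p \is k.-homog ->
  top_coef k (ev p v)%:MP (line_poly v p).
Proof.
move=> /dhomogP hp.
have top_m (m : 'X_{1..3}) :
  top_coef (mdeg m) (\prod_i (v 0 i) ^+ m i)%:MP
    (mmap1 (fun i => ('X_i)%:P + (v 0 i)%:MP%:P * 'X) m).
  rewrite /mmap1 mdegE !big_ord_recl !big_ord0 !mpolyCM.
  have tl (i : 'I_3) : top_coef (m i) (v 0 i ^+ m i)%:MP
      ((('X_i)%:P + (v 0 i)%:MP%:P * 'X) ^+ m i).
    have := @top_coefX {mpoly K[3]} 1 (v 0 i)%:MP (('X_i)%:P + (v 0 i)%:MP%:P * 'X) (m i).
    rewrite mul1n -rmorphXn; apply; split.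
      by rewrite addrC -[('X_i)]mulr1 size_MXaddC; case: ifP => // _; rewrite ltnS size_polyC; case: eqP.
    by rewrite coefD coefC coefMX coefC add0r.
  do 3! apply: (top_coefM (tl _)).
  by rewrite mpolyC1; split; rewrite ?size_poly1 ?coef1.
rewrite /line_poly /mmap /ev mevalE raddf_sum /=.
rewrite [X in top_coef k X _]big_seq [X in top_coef k _ X]big_seq.
elim/big_ind2: _ => [|a F b G [sF <-] [sG <-]|m /hp <-].
- by split; rewrite ?size_poly0 ?coef0.
- split; last by rewrite coefD.
  by apply: leq_trans (size_polyD _ _) _; rewrite geq_max sF.
- have [s c] := top_m m; rewrite mpolyCM -c; split; last by rewrite coefCM.
  by rewrite mul_polyC; apply: leq_trans (size_scale_leq _ _) _.
Qed.

Lemma at_line_polyM x v : {morph (fun p => at_pt x (line_poly v p)) : p q / p * q}.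
Proof. by move=> p q; rewrite line_polyM; apply: at_ptM. Qed.

Lemma pihomogMr p q l (e : nat) : q \is l.-homog ->
  pihomog mdeg (e + l) (p * q) = pihomog mdeg e p * q.
Proof.
move=> hq; rewrite {1}(pihomog_partitionE (leqnn (mmeasure mdeg p))).
rewrite mulr_suml raddf_sum /=.
have term j : pihomog mdeg (e + l) (pihomog mdeg j p * q) =
   (pihomog mdeg e p * q) *+ (j == e).
  have hj : pihomog mdeg j p * q \is (j + l).-homog.
    by apply: dhomogM => //; apply: pihomogP.
  case: eqP => [->|/eqP ne]; first by rewrite pihomog_dE // dhomogM // pihomogP.
  by rewrite (pihomog_ne0 _ hj) // eqn_add2r.
under eq_bigr => i _ do rewrite term.
have [lt|le] := ltnP e (mmeasure mdeg p).
  rewrite (bigD1 (Ordinal lt)) //= eqxx big1 ?addr0 // => i ne.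
  by rewrite (_ : (i == e :> nat) = false) //; apply: contraNF ne => /eqP ie; apply/eqP/val_inj.
rewrite big1 => [|i _]; last by rewrite (_ : (i == e :> nat) = false) //; apply/negbTE; have := ltn_ord i; lia.
suff -> : pihomog mdeg e p = 0 by rewrite mul0r.
rewrite pihomogE big_seq_cond big_pred0 // => m.
by apply: contraTF le => /andP[/mmeasure_mnm_lt lt_m /eqP <-]; rewrite -ltnNge.
Qed.

(* If s = p / q near v and q(v) <> 0, division by q(X + T v), which is unitary in
   T, has zero remainder: on each line parallel to v the section is a polynomial,
   because it is regular there, so q divides p along the line. *)
Lemma global_section (e : nat) s : section_O e%:Z (@P2 K) s ->
  exists2 P : {mpoly K[3]}, P \is e.-homog & forall x, x != 0 -> s x = ev P x.
Proof.
move=> sP; pose v : 'rV[K]_3 := \row_i (i == 0)%:R.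
have v0 : v != 0.
  by apply/eqP => /rowP/(_ 0)/eqP; rewrite !mxE eqxx oner_eq0.
have [V [p0 [q0 [k [l [[oV _ Vv] [hp0 hq0 kl sV0]]]]]]] := sP v v0.
have [c0 _] := sV0 v Vv; set c := ev q0 v in c0.
(* Dividing by the value [c] at [v] makes [line_poly v q] monic, as division over the ring [{mpoly
   K[3]}] requires. *)
have [p [q [hp hq qv sV]]] : exists p q, [/\ p \is (e + l).-homog, q \is l.-homog,
    ev q v = 1 & forall x, V x -> ev q x != 0 /\ s x = ev p x / ev q x].
  exists (c^-1 *: p0), (c^-1 *: q0); split.
  - by rewrite (_ : e + l = k)%N ?dhomogZ //; lia.
  - by rewrite dhomogZ.
  - by rewrite evZ mulVf.
  - move=> x /sV0[qx ->]; rewrite !evZ mulf_neq0 ?invr_eq0 //; split=> //.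
    by rewrite -mulf_div divff ?invr_eq0 // mul1r.
have cross x : x != 0 -> exists p' q', [/\ ev q' x != 0, s x = ev p' x / ev q' x &
    p' * q = p * q'].
  move=> x0; have [V' [p' [q' [k' [l' [[oV' _ V'x] [hp' hq' _ sV']]]]]]] := sP x x0.
  have [q'x sx] := sV' x V'x.
  exists p', q'; split=> //.
  by apply: (frac_unique oV' oV _ _ sV' sV); [exists x | exists v].
have [P [Q [A [R [[EP EQ] mQ PE szR]]]]] : exists P Q A R,
    [/\ P = line_poly v p /\ Q = line_poly v q, Q \is monic, P = A * Q + R &
        (size R < size Q)%N].
  have [sQ cQ] := line_poly_top v hq; rewrite qv mpolyC1 in cQ.
  have szQ : size (line_poly v q) = l.+1.
    apply/eqP; rewrite eqn_leq sQ /=; apply: contraT; rewrite -leqNgt => le.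
    by have /eqP := cQ; rewrite nth_default // eq_sym oner_eq0.
  have mQ : line_poly v q \is monic by rewrite monicE lead_coefE szQ cQ.
  exists (line_poly v p), (line_poly v q).
  exists (Pdiv.Ring.rdivp (line_poly v p) (line_poly v q)).
  exists (Pdiv.Ring.rmodp (line_poly v p) (line_poly v q)); split=> //.
    exact: (Pdiv.RingMonic.rdivp_eq mQ).
  by rewrite Pdiv.Ring.ltn_rmodpN0 // monic_neq0.
have R0 : R = 0.
  (* As [v] is the first unit vector, the line [x + t v] avoids the origin wherever the coordinate
     [i1] of [x] is nonzero; the factor ['X_i1] disposes of the other points. *)
  pose i1 : 'I_3 := inord 1.
  have X1 : 'X_i1 != 0 :> {mpoly K[3]} by rewrite -msize_poly_eq0 msizeX.
  apply/polyP => j; rewrite coef0; apply: (mulfI X1); rewrite mulr0.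
  apply: mpoly_ev_inj => x _; rewrite evM ev0 evXU.
  have [->|x1] := eqVneq (x 0 i1) 0; first by rewrite mul0r.
  suff -> : ev R`_j x = (at_pt x R)`_j.
    suff -> : at_pt x R = 0 by rewrite coef0 mulr0.
    have mQx : at_pt x Q \is monic by exact: monic_map.
    have dvdP : (at_pt x Q %| at_pt x P)%R.
      apply: poly_dvd_local; first exact: monic_neq0.
      move=> t; have y0 : x + t *: v != 0.
        apply: contraNneq x1 => /rowP/(_ i1); rewrite !mxE -val_eqE /= inordK // mulr0 addr0.
        by move->.
      have [p' [q' [q'y _ pq]]] := cross _ y0.
      exists (at_pt x (line_poly v p')), (at_pt x (line_poly v q')).
      split; first by rewrite at_ptE.
      rewrite EP EQ; have := congr1 (fun r => at_pt x (line_poly v r)) pq.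
      by move=> h; apply: etrans (etrans (esym (at_line_polyM x v p' q)) h) (at_line_polyM x v p q').
    have dvdR : (at_pt x Q %| at_pt x R)%R.
      by move: dvdP; rewrite PE at_ptD at_ptM (dvdp_addr _ (dvdp_mull _ (dvdpp _))).
    apply/eqP; apply: contraLR szR => Rx0; rewrite -leqNgt.
    apply: leq_trans (size_poly _ _ : size (at_pt x R) <= size R)%N.
    apply: leq_trans (dvdp_leq Rx0 dvdR).
    by rewrite /at_pt size_map_poly_id0 // (monicP mQ) rmorph1 oner_eq0.
  by rewrite /at_pt coef_map.
have pE : p = A.[0] * q.
  by rewrite -(line_poly_at0 v p) -EP PE R0 addr0 hornerM EQ line_poly_at0.
(* Homogeneity is obtained by passing to the component of degree [e] of [A.[0]], which has the same
   product [p] with [q]. *)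
exists (pihomog mdeg e A.[0]) => [|x x0]; first exact: pihomogP.
have {}pE : p = pihomog mdeg e A.[0] * q.
  by have := pihomogMr A.[0] e hq; rewrite -pE pihomog_dE.
have q_neq0 : q != 0 by apply: contra_eq_neq qv => ->; rewrite ev0 eq_sym oner_eq0.
have [p' [q' [q'x -> pq]]] := cross x x0.
have -> : p' = pihomog mdeg e A.[0] * q'.
  by apply: (mulIf q_neq0); rewrite pq {1}pE mulrAC.
by rewrite evM mulfK.
Qed.
End GlobalSections.

Section Rank.
Variables (K : closedFieldType) (n : nat) (e : int) (F : sections K n).
Hypothesis sF : subsheaf e F.

Lemma section_O1 (U : region K) : zopen U -> section_O 0 U (fun=> 1).
Proof.
move=> oU; have h1 : (1 : {mpoly K[3]}) \is 0.-homog by exact: dhomog1.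
apply: section_O_restr (section_O_poly h1 oU) oU _ _ => //.
by move=> x _; rewrite ev1.
Qed.

Lemma section_ON e' (U : region K) s : zopen U -> section_O e' U s ->
  section_O e' U (fun x => - s x).
Proof.
move=> oU sU.
have h : section_O 0 U (fun=> - 1 : K).
  have h1 : (- 1 : {mpoly K[3]}) \is 0.-homog by rewrite rpredN; exact: dhomog1.
  apply: section_O_restr (section_O_poly h1 oU) oU _ _ => // x _.
  by rewrite /ev mevalN meval1.
have := section_OM h sU; rewrite add0r => h2.
by apply: section_O_restr h2 oU _ _ => // x _; rewrite mulN1r.
Qed.

(* Two local bases are related by matrices A and B with A B = 1 at a point. *)
Lemma rank_le r r' : is_rank F r -> is_rank F r' -> (r <= r')%N.
Proof.
move=> [U [b [oU Un bF hU]]] [U' [b' [oU' Un' bF' hU']]].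
pose V x := U x /\ U' x; have oV : zopen V by apply: zopenI.
have VU : subregion V U by move=> x [].
have VU' : subregion V U' by move=> x [].
have [x Vx] : exists x, V x by apply: zopen_meet.
have /fin_all_exists[a aP] j : exists a : 'I_r' -> 'rV[K]_3 -> K,
    (forall l, section_O 0 V (a l)) /\ (forall y, V y -> b j y = \sum_l a l y *: b' l y).
  have [_] := hU' V oV VU'; apply.
  exact: (subsheaf_restr sF oU oV VU (bF j)).
have /fin_all_exists[c cP] l : exists c : 'I_r -> 'rV[K]_3 -> K,
    (forall j, section_O 0 V (c j)) /\ (forall y, V y -> b' l y = \sum_j c j y *: b j y).
  have [_] := hU V oV VU; apply.
  exact: (subsheaf_restr sF oU' oV VU' (bF' l)).
have [indep _] := hU V oV VU.
apply: (@mulmx1_min K r r' (\matrix_(j, l) a j l x) (\matrix_(l, j) c l j x)).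
apply/matrixP => j j'; rewrite !mxE.
apply/eqP; rewrite -subr_eq0; apply/eqP.
pose g (i : 'I_r) y := \sum_l a j l y * c l i y - (j == i)%:R.
transitivity (g j' x).
  by congr (_ - _); apply: eq_bigr => l _; rewrite !mxE.
apply: indep (Vx); rewrite /g.
- move=> i; apply: section_OD.
    apply: section_O_sum => // l; rewrite -[0]addr0; apply: section_OM.
      by have [] := aP j.
    by have [] := cP l.
  apply: section_ON => //; case: (j == i); [exact: section_O1 | exact: section_O0].
- move=> y Vy; under eq_bigr => i _ do rewrite scalerBl.
  rewrite sumrB [X in _ - X](bigD1 j) //= eqxx scale1r [X in _ - (_ + X)]big1 ?addr0; last first.
    by move=> i /negPf ne; rewrite eq_sym ne scale0r.
  have [_ ->] := aP j => //; apply/eqP; rewrite subr_eq0; apply/eqP.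
  under eq_bigr => i _ do rewrite scaler_suml.
  rewrite exchange_big /=; apply: eq_bigr => l _.
  have [_ ->] := cP l => //; rewrite scaler_sumr.
  by apply: eq_bigr => i _; rewrite scalerA.
Qed.
End Rank.

Lemma rank_unique (K : closedFieldType) n e (F : sections K n) r r' :
  subsheaf e F -> is_rank F r -> is_rank F r' -> r = r'.
Proof. by move=> sF h h'; apply/eqP; rewrite eqn_leq !(rank_le sF). Qed.

(** * The syzygy bundle *)

Section Syzygies.
Variables (K : closedFieldType) (n d : nat) (f : 'I_n -> {mpoly K[3]}).
Hypothesis f_homog : forall i, f i \is d.-homog.
Variable vtx : 'I_3 -> 'I_n.
Hypothesis f_vtx : forall j, f (vtx j) = 'X_j ^+ d.
Local Notation E := (Syz d f).
Implicit Types (U V W : region K) (x : 'rV[K]_3).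

Lemma Syz_subsheaf : subsheaf (- d%:Z) E.
Proof.
split.
- by move=> U s _ [].
- move=> U oU; split=> [i|x Ux].
    by apply: section_O_restr (section_O0 _ oU) oU _ _ => // x _; rewrite mxE.
  by rewrite big1 // => i _; rewrite mxE mulr0.
- move=> U s t oU [sU sS] [tU tS]; split=> [i|x Ux].
    by apply: section_O_restr (section_OD (sU i) (tU i)) oU _ _ => // x _; rewrite mxE.
  under eq_bigr => i _ do rewrite mxE mulrDr.
  by rewrite big_split /= sS // tS // addr0.
- move=> U g s oU gU [sU sS]; split=> [i|x Ux].
    have := section_OM gU (sU i); rewrite add0r => h.
    by apply: section_O_restr h oU _ _ => // x _; rewrite mxE.
  under eq_bigr => i _ do rewrite mxE mulrCA.
  by rewrite -mulr_sumr sS // mulr0.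
- move=> U W s t oU oW WU [sU sS] ts; split=> [i|x Wx].
    by apply: section_O_restr (sU i) oW WU _ => x Wx; rewrite ts.
  by under eq_bigr => i _ do rewrite ts //; apply: sS; apply: WU.
- move=> U s oU h; split=> [i|x Ux].
    apply: section_O_local => // x Ux; have [V [oV VU Vx [sV _]]] := h x Ux.
    by exists V; split=> //; apply: sV.
  by have [V [oV VU Vx [_ sS]]] := h x Ux; apply: sS.
Qed.

Definition chart (j : 'I_3) : region K := Dopen 'X_j.

Lemma zopen_chart j : zopen (chart j).
Proof. by apply: (@zopen_D _ _ 1); have := @dhomogXUn K j 1; rewrite expr1. Qed.

Lemma chart_neq0 j x : chart j x -> x 0 j != 0.
Proof. by case; rewrite evXU. Qed.

Lemma chart_cover x : x != 0 -> exists j, chart j x.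
Proof. by move=> /[dup] x0 /coord_neq0[j xj]; exists j; split; rewrite ?evXU. Qed.

Definition frame_num (j : 'I_3) (i l : 'I_n) : {mpoly K[3]} :=
  (i == l)%:R * 'X_j ^+ d - (l == vtx j)%:R * f i.

(* The syzygy e_i / X_j^d - f_i e_{vtx j} / X_j^(2 d). *)
Definition frame (j : 'I_3) (i : 'I_n) x : 'rV[K]_n :=
  \row_l (ev (frame_num j i l) x / ev ('X_j ^+ (2 * d)) x).

Lemma ev_nat (b : nat) x : ev b%:R x = b%:R.
Proof. exact: (rmorph_nat (meval (fun i => x 0 i))). Qed.

Lemma frameE j i l x : frame j i x 0 l =
  ((i == l)%:R * x 0 j ^+ d - (l == vtx j)%:R * ev (f i) x) / x 0 j ^+ (2 * d).
Proof. by rewrite mxE /frame_num evB !evM !ev_nat !evXn !evXU. Qed.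

Lemma frame_section j i V : zopen V -> subregion V (chart j) -> E V (frame j i).
Proof.
move=> oV Vj; split=> [l|x /Vj/chart_neq0 xj].
  have hn : frame_num j i l \is d.-homog.
    have hb (b : bool) (p : {mpoly K[3]}) : p \is d.-homog -> b%:R * p \is d.-homog.
      by case: b; rewrite ?mul1r // mul0r dhomog0.
    by apply: rpredB; apply: hb; rewrite ?dhomogXUn.
  have hd := @dhomogXUn K j (2 * d).
  have kl : d%:Z - (2 * d)%:Z = - d%:Z by lia.
  apply: section_O_restr (section_O_frac hn hd kl oV _) oV _ _ => // x.
    by move=> /Vj/chart_neq0 xj; rewrite evXn evXU expf_neq0.
  by rewrite mxE.
under eq_bigr => l _ do rewrite frameE mulrA mulrBr mulrBl.
rewrite sumrB (bigD1 i) //= [X in _ - X](bigD1 (vtx j)) //= !eqxx.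
rewrite big1 => [|l /negPf ne]; last by rewrite eq_sym ne mul0r mulr0 mul0r.
rewrite big1 => [|l /negPf ne]; last by rewrite ne mul0r mulr0 mul0r.
by rewrite !addr0 f_vtx evXn evXU !mul1r [X in _ - X / _]mulrC subrr.
Qed.

(** The corrections at [vtx j] add up to a multiple of the relation [\sum_i f_i t_i], which vanishes
    on a syzygy. *)
Lemma frame_span j V t x : subregion V (chart j) -> E V t -> V x ->
  t x = \sum_i (t x 0 i * x 0 j ^+ d) *: frame j i x.
Proof.
move=> Vj [_ tS] Vx; have xj := chart_neq0 (Vj _ Vx).
apply/rowP => l; rewrite summxE.
under eq_bigr => i _ do rewrite mxE frameE mulrA mulrBr mulrBl.
rewrite sumrB (bigD1 l) //= eqxx mul1r big1 => [|i /negPf ne]; last by rewrite ne mul0r mulr0 mul0r.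
rewrite addr0 (_ : \sum_i _ = 0) ?subr0.
  by rewrite mul2n -addnn exprD -mulf_div mulfK ?expf_neq0 // divff ?mulr1 ?expf_neq0.
transitivity ((l == vtx j)%:R * x 0 j ^+ d / x 0 j ^+ (2 * d) * \sum_i ev (f i) x * t x 0 i).
  by rewrite mulr_sumr; apply: eq_bigr => i _; ring.
by rewrite tS // mulr0.
Qed.

Lemma frame_vtx j x : frame j (vtx j) x = 0.
Proof.
apply/rowP => l; rewrite frameE mxE f_vtx evXn evXU eq_sym.
by rewrite subrr mul0r.
Qed.

Lemma frame_coef_section j V (t : 'rV[K]_3 -> 'rV[K]_n) i : zopen V -> section_On (- d%:Z) V t ->
  section_O 0 V (fun x => t x 0 i * x 0 j ^+ d).
Proof.
move=> oV tV; have := section_OM (tV i) (section_O_poly (@dhomogXUn K j d) oV).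
rewrite addNr => h; apply: section_O_restr h oV _ _ => // x _.
by rewrite evXn evXU.
Qed.

Lemma Syz_coherent : coherent_subsheaf (- d%:Z) E.
Proof.
split; first exact: Syz_subsheaf.
move=> x x0; have [j jx] := chart_cover x0.
exists (chart j), n, (frame j); split=> //; first exact: zopen_chart.
  by move=> i; apply: frame_section => //; apply: zopen_chart.
move=> W t oW Wj Et y Wy; exists W, (fun i x => t x 0 i * x 0 j ^+ d); split=> //.
  by move=> i; apply: frame_coef_section; case: Et.
by move=> z Wz; apply: frame_span Et Wz.
Qed.

(** The frame vector at [vtx j] is zero. Each of the other [n - 1] has a nonzero entry in its own
    coordinate, where the rest of them vanish. *)
Lemma Syz_rank : is_rank E n.-1.
Proof.
pose j : 'I_3 := 0; exists (chart j), (fun i => frame j (lift (vtx j) i)); split.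
- exact: zopen_chart.
- exists (\row_i (i == j)%:R); split; last by rewrite evXU mxE eqxx oner_eq0.
  by apply/eqP => /rowP/(_ j)/eqP; rewrite !mxE eqxx oner_eq0.
- by move=> i; apply: frame_section => //; apply: zopen_chart.
move=> V oV Vj; split=> [a _ rel i x Vx|t Et].
  have xj := chart_neq0 (Vj _ Vx).
  have := congr1 (fun u : 'rV[K]_n => u 0 (lift (vtx j) i)) (rel x Vx).
  rewrite summxE (bigD1 i) //= mxE frameE eqxx mul1r eq_sym (negPf (neq_lift _ _)) mul0r subr0.
  rewrite big1 => [|i' ne]; last first.
    rewrite mxE frameE (inj_eq lift_inj) (negPf ne) eq_sym (negPf (neq_lift _ _)).
    by rewrite !mul0r subrr mul0r mulr0.
  rewrite addr0 mxE => /eqP; rewrite mulf_eq0 => /orP[/eqP //|].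
  by rewrite mulf_eq0 invr_eq0 !expf_eq0 (negPf xj) !andbF.
exists (fun i x => t x 0 (lift (vtx j) i) * x 0 j ^+ d); split=> [i|x Vx].
  by apply: frame_coef_section; case: Et.
rewrite [LHS](frame_span Vj Et Vx) (bigD1 (vtx j)) //= frame_vtx scaler0 add0r.
rewrite (reindex_omap (lift (vtx j)) (unlift (vtx j))) => [|l]; last first.
  by case: unliftP => [l' ->|->] //; rewrite eqxx.
by rewrite [LHS](eq_bigl xpredT) // => i; rewrite liftK eqxx andbT eq_sym neq_lift.
Qed.
End Syzygies.

(** * Global sections of the twists as tuples of forms *)

Section Twists.
Variables (K : closedFieldType) (n d : nat) (f : 'I_n -> {mpoly K[3]}).
Hypothesis f_homog : forall i, f i \is d.-homog.
Local Notation E := (Syz d f).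
Implicit Types (U V W : region K) (x : 'rV[K]_3) (F : sections K n).

Definition poly_row (g : 'I_n -> {mpoly K[3]}) x : 'rV[K]_n := \row_i ev (g i) x.

Lemma invX_section j (k : nat) V : zopen V -> subregion V (@chart K j) ->
  section_O (- k%:Z) V (fun x => (x 0 j ^+ k)^-1).
Proof.
move=> oV Vj; have h1 : (1 : {mpoly K[3]}) \is 0.-homog by exact: dhomog1.
apply: section_O_restr (section_O_frac (e := - k%:Z) h1 (@dhomogXUn K j k) _ oV _) oV _ _ => //.
- by lia.
- by move=> x /Vj/chart_neq0 xj; rewrite evXn evXU expf_neq0.
- by move=> x _; rewrite ev1 evXn evXU div1r.
Qed.

(** Multiplying by the local section [1 / X_j ^ k] brings a section of the twist back into [F],
    hence among the syzygies. *)
Lemma twist_poly F k s : sub_sections F E -> (d <= k)%N ->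
  twist (- d%:Z) F k%:Z (@P2 K) s ->
  exists g, [/\ forall i, g i \is (k - d).-homog,
    forall x, x != 0 -> s x = poly_row g x & \sum_i f i * g i = 0].
Proof.
move=> FE dk [sO sF].
have dkE : - d%:Z + k%:Z = (k - d)%N%:Z by lia.
have /fin_all_exists[g gP] i : exists g, g \is (k - d).-homog /\
    forall x, x != 0 -> s x 0 i = ev g x.
  by have := sO i; rewrite dkE => /global_section[P hP sP]; exists P.
have sE x : x != 0 -> s x = poly_row g x.
  by move=> x0; apply/rowP => i; rewrite mxE; apply: (proj2 (gP i)).
exists g; split=> //; first by move=> i; have [] := gP i.
apply: mpoly_ev_inj => x x0; have [j jx] := chart_cover x0.
have oj := @zopen_chart K j.
have := sF _ _ oj (fun x Ux => zopen_neq0 oj Ux) (@invX_section j k _ oj (fun x => id)).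
move=> /(FE _ _ oj)[_ /(_ x jx)] h; rewrite ev0 ev_sum.
have xj : x 0 j ^+ k != 0 by rewrite expf_neq0 // chart_neq0.
apply: (mulfI (invr_neq0 xj)); rewrite mulr0 -[RHS]h mulr_sumr.
by apply: eq_bigr => i _; rewrite evM !mxE (proj2 (gP i)) // mulrCA.
Qed.

Lemma poly_row_section k g V : zopen V -> (forall i, g i \is k.-homog) ->
  section_On k%:Z V (poly_row g).
Proof.
move=> oV hg i; apply: section_O_restr (section_O_poly (hg i) oV) oV _ _ => // x _.
by rewrite mxE.
Qed.

Lemma Syz_twist_poly k g : (d <= k)%N -> (forall i, g i \is (k - d).-homog) ->
  \sum_i f i * g i = 0 -> twist (- d%:Z) E k%:Z (@P2 K) (poly_row g).
Proof.
move=> dk hg fg; have dkE : - d%:Z + k%:Z = (k - d)%N%:Z by lia.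
split; first by rewrite dkE; apply: poly_row_section => //; apply: zopen_P2.
move=> V c oV _ cV; split=> [i|x Vx].
  have := section_OM cV (poly_row_section oV hg i).
  rewrite -dkE addrCA addNr addr0 => h.
  by apply: section_O_restr h oV _ _ => // x _; rewrite mxE.
transitivity (c x * ev (\sum_i f i * g i) x); last by rewrite fg ev0 mulr0.
rewrite ev_sum mulr_sumr; apply: eq_bigr => i _.
by rewrite evM !mxE mulrCA.
Qed.

Lemma twistMX F k (j : 'I_3) s : subsheaf (- d%:Z) F ->
  twist (- d%:Z) F k%:Z (@P2 K) s ->
  twist (- d%:Z) F k.+1%:Z (@P2 K) (fun x => x 0 j *: s x).
Proof.
move=> sF [sO sT]; have hX : ('X_j : {mpoly K[3]}) \is 1.-homog.
  by have := @dhomogXUn K j 1; rewrite expr1.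
split=> [i|V c oV VP cV].
  have := section_OM (section_O_poly hX (@zopen_P2 K)) (sO i).
  rewrite addrCA -PoszD add1n => h.
  by apply: section_O_restr h (@zopen_P2 K) _ _ => // x _; rewrite mxE evXU.
have h := section_OM cV (section_O_poly hX oV).
have e : - k.+1%:Z + 1%N%:Z = - k%:Z by lia.
rewrite e in h; apply: (subsheaf_restr sF oV oV _ (sT V _ oV VP h)) => // x _.
by rewrite evXU scalerA.
Qed.

Lemma twistD F k s t : subsheaf (- d%:Z) F ->
  twist (- d%:Z) F k%:Z (@P2 K) s -> twist (- d%:Z) F k%:Z (@P2 K) t ->
  twist (- d%:Z) F k%:Z (@P2 K) (fun x => s x + t x).
Proof.
move=> sF [sO sT] [tO tT]; split=> [i|V c oV VP cV].
  by apply: section_O_restr (section_OD (sO i) (tO i)) (@zopen_P2 K) _ _ => // x _; rewrite mxE.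
apply: (subsheaf_restr sF oV oV _ (subsheaf_add sF oV (sT V c oV VP cV) (tT V c oV VP cV))) => // x _.
by rewrite scalerDr.
Qed.

Lemma twistZ F k a s : subsheaf (- d%:Z) F ->
  twist (- d%:Z) F k%:Z (@P2 K) s -> twist (- d%:Z) F k%:Z (@P2 K) (fun x => a *: s x).
Proof.
have h0 : (a%:MP : {mpoly K[3]}) \is 0.-homog by rewrite -[a]mulr1 mpolyCM mpolyC1 mul_mpolyC dhomogZ // dhomog1.
have ha V : zopen V -> section_O 0 V (fun=> a).
  by move=> oV; apply: section_O_restr (section_O_poly h0 oV) oV _ _ => // x _; rewrite /ev mevalC.
move=> sF [sO sT]; split=> [i|V c oV VP cV].
  have := section_OM (ha _ (@zopen_P2 K)) (sO i); rewrite add0r => h.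
  by apply: section_O_restr h (@zopen_P2 K) _ _ => // x _; rewrite mxE.
apply: (subsheaf_restr sF oV oV _ (subsheaf_scale sF oV (ha V oV) (sT V c oV VP cV))) => // x _.
by rewrite !scalerA mulrC.
Qed.

Lemma twist0 F k : subsheaf (- d%:Z) F -> twist (- d%:Z) F k%:Z (@P2 K) (fun=> 0).
Proof.
move=> sF; split=> [i|V c oV VP cV].
  by apply: section_O_restr (section_O0 _ (@zopen_P2 K)) (@zopen_P2 K) _ _ => // x _; rewrite mxE.
by apply: (subsheaf_restr sF oV oV _ (subsheaf_zero sF oV)) => // x _; rewrite scaler0.
Qed.

Lemma twist_ext F k s t : subsheaf (- d%:Z) F ->
  (forall x, x != 0 -> t x = s x) ->
  twist (- d%:Z) F k%:Z (@P2 K) s -> twist (- d%:Z) F k%:Z (@P2 K) t.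
Proof.
move=> sF ts [sO sT]; split=> [i|V c oV VP cV].
  by apply: section_O_restr (sO i) (@zopen_P2 K) _ _ => // x x0; rewrite ts.
apply: (subsheaf_restr sF oV oV _ (sT V c oV VP cV)) => // x Vx.
by rewrite ts //; apply: zopen_neq0 Vx.
Qed.
End Twists.

Section SyzygyMap.
Variables (K : closedFieldType) (n d k : nat) (f : 'I_n -> {mpoly K[3]}).
Hypothesis f_homog : forall i, f i \is d.-homog.

Definition syz_map_fun (dk : (d <= k)%N) (g : {ffun 'I_n -> dhomog 3 K (k - d)}) :
    {mpoly K[3]} := \sum_i f i * (g i : {mpoly K[3]}).

Lemma syz_map_homog dk g : syz_map_fun dk g \is k.-homog.
Proof.
apply: rpred_sum => i _.
by have := dhomogM (f_homog i) (dhomog_is_dhomog (g i)); rewrite (subnKC dk).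
Qed.

Definition syz_map dk g : dhomog 3 K k := DHomog (syz_map_homog dk g).

Lemma syz_map_linear dk : linear (syz_map dk).
Proof.
move=> a g h; apply: val_inj; rewrite /= /syz_map_fun scaler_sumr -big_split /=.
by apply: eq_bigr => i _; rewrite !ffunE /= mulrDr scalerAr.
Qed.

HB.instance Definition _ dk := GRing.isLinear.Build K
  {ffun 'I_n -> dhomog 3 K (k - d)} (dhomog 3 K k) _ (syz_map dk) (syz_map_linear dk).
End SyzygyMap.

(** * Hilbert function and Chern class of the syzygy bundle *)

Section HilbertSyz.
Variables (K : closedFieldType) (n d : nat) (m : 'I_n -> 'X_{1..3}).
Hypothesis m_deg : forall i, mdeg (m i) = d.
Variable vtx : 'I_3 -> 'I_n.
Hypothesis m_vtx : forall j, m (vtx j) = (U_(j) *+ d)%MM.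
Local Notation f := (monomials K m).
Local Notation E := (Syz d f).

Lemma monomials_homog i : f i \is d.-homog.
Proof. by rewrite dhomogX; apply/eqP/m_deg. Qed.

Lemma monomials_vtx j : f (vtx j) = 'X_j ^+ d.
Proof. by rewrite /monomials m_vtx mpolyXn. Qed.

Lemma mdeg3 (u : 'X_{1..3}) : mdeg u = (u ord0 + u (inord 1) + u (inord 2))%N.
Proof.
rewrite mdegE !big_ord_recl big_ord0 addn0 addnA.
by congr (_ + u _ + u _)%N; apply: val_inj; rewrite /= inordK.
Qed.

(** Pigeonhole on three exponents. From degree [3 * d] on, the pure powers alone generate all forms,
    which serves both the Hilbert function and the primary ideal. *)
Lemma dvd_vertex (u : 'X_{1..3}) : (3 * d <= mdeg u)%N -> exists j, (m (vtx j) <= u)%MM.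
Proof.
rewrite mdeg3 => le.
have [j dj] : exists j : 'I_3, (d <= u j)%N.
  have [?|?] := leqP d (u ord0); first by exists ord0.
  have [?|?] := leqP d (u (inord 1)); first by exists (inord 1).
  by exists (inord 2); lia.
exists j; rewrite m_vtx; apply/mnm_lepP => i; rewrite mulmnE mnm1E.
by case: eqP => [<-|]; rewrite ?mul1n.
Qed.

Lemma monomials_generate k (P : {mpoly K[3]}) : (3 * d <= k)%N -> P \is k.-homog ->
  exists g : 'I_n -> {mpoly K[3]}, (forall i, g i \is (k - d).-homog) /\ \sum_i f i * g i = P.
Proof.
move=> dk /dhomogP hP; rewrite [P]mpolyE big_seq.
elim/big_ind: _ => [|p q [g [hg <-]] [h [hh <-]]|u uP].
- exists (fun=> 0); split=> [i|]; first exact: dhomog0.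
  by rewrite big1 // => i _; rewrite mulr0.
- exists (fun i => g i + h i); split=> [i|]; first exact: rpredD.
  by rewrite -big_split /=; apply: eq_bigr => i _; rewrite mulrDr.
have du := hP u uP.
have [j mu] : exists j, (m (vtx j) <= u)%MM by apply: dvd_vertex; rewrite du.
exists (fun i => (i == vtx j)%:R *: (P@_u *: 'X_[u - m (vtx j)])); split=> [i|].
  apply/dhomogZ/dhomogZ; rewrite dhomogX; apply/eqP => /=.
  by have := mdegD (u - m (vtx j)) (m (vtx j)); rewrite submK // du m_deg => ->; rewrite addnK.
rewrite (bigD1 (vtx j)) //= eqxx scale1r big1 => [|i /negPf ->]; last by rewrite scale0r mulr0.
by rewrite addr0 -scalerAr -mpolyXD addmC submK.
Qed.

(** In these degrees the monomials map onto all forms of degree [k], so the kernel has the dimension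
    given by rank and nullity. *)
Lemma Syz_h0 k : (3 * d <= k)%N -> exists2 h, is_h0 (twist (- d%:Z) E k%:Z) h &
  (h + 'C(k + 2, 2) = n * 'C(k - d + 2, 2))%N.
Proof.
move=> dk; have dk' : (d <= k)%N by lia.
pose phi := linfun (syz_map monomials_homog dk').
have phiE g : (phi g : {mpoly K[3]}) = \sum_i f i * (g i : {mpoly K[3]}).
  by rewrite /phi lfunE.
have surj : limg phi = fullv.
  apply/vspaceP => P; rewrite memvf; apply/memv_imgP.
  have [g [hg gP]] := monomials_generate dk (dhomog_is_dhomog P).
  exists [ffun i => DHomog (hg i)]; first exact: memvf.
  by apply: val_inj; rewrite /= phiE -gP; apply: eq_bigr => i _; rewrite ffunE.
have dimk l : dim (dhomog 3 K l) = 'C(l + 2, 2).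
  by rewrite -(@bin_sub (l + 2) 2) ?addnK // leq_addl.
have dim_ker : (\dim (lker phi) + 'C(k + 2, 2) = n * 'C(k - d + 2, 2))%N.
  have := limg_ker_dim phi fullv; rewrite capfv surj !dimvf -dimk.
  have -> : dim {ffun 'I_n -> dhomog 3 K (k - d)} = (n * dim (dhomog 3 K (k - d)))%N.
    by rewrite /dim /= card_ord.
  by rewrite -dimk => <-.
exists (\dim (lker phi)) => //.
pose b j : 'I_n -> {mpoly K[3]} := fun i => (vbasis (lker phi))`_j i.
exists (fun j : 'I_(\dim (lker phi)) => poly_row (b j)); split=> [j|t tE].
  apply: (Syz_twist_poly dk') => [i|]; first exact: dhomog_is_dhomog.
  rewrite -phiE; have : (vbasis (lker phi))`_j \in lker phi.
    by apply: vbasis_mem; apply: mem_nth; rewrite size_tuple.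
  by rewrite memv_ker => /eqP ->.
have [g [hg tg fg]] := twist_poly (fun _ _ _ h => h) dk' tE.
pose G := [ffun i => DHomog (hg i)].
have Gker : G \in lker phi.
  rewrite memv_ker; apply/eqP/val_inj; rewrite /= phiE -[RHS]fg.
  by apply: eq_bigr => i _; rewrite ffunE.
have sum_row (c : 'I_(\dim (lker phi)) -> K) x :
  \sum_j c j *: poly_row (b j) x = \row_i ev ((\sum_j c j *: (vbasis (lker phi))`_j) i) x.
  apply/rowP => i; rewrite summxE mxE sum_ffunE.
  rewrite (raddf_sum (@mpoly_of_dhomog 3 K (k - d))) /= ev_sum.
  by apply: eq_bigr => j _; rewrite !mxE !ffunE /= evZ.
exists (\row_j coord (vbasis (lker phi)) j G); split=> [x x0|c cP].
  rewrite tg //; under eq_bigr => j _ do rewrite mxE.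
  rewrite sum_row -coord_vbasis //; apply/rowP => i; rewrite !mxE ffunE.
  done.
have -> : G = \sum_j c 0 j *: (vbasis (lker phi))`_j.
  apply/ffunP => i; apply: val_inj; apply: mpoly_ev_inj => x x0.
  have := cP x x0; rewrite sum_row tg // => /rowP/(_ i); rewrite !mxE => <-.
  by rewrite ffunE.
apply/rowP => j; rewrite mxE coord_sum_free //.
exact: basis_free (vbasisP _).
Qed.

Lemma Syz_c1 : (0 < n)%N -> is_c1 (- d%:Z) E (- (n * d)%N%:Z).
Proof.
move=> n0; exists n.-1; split; first exact: (Syz_rank monomials_homog monomials_vtx).
(* The constant is [n] times that of ['C(k - d + 2, 2) = 'C(k + 2, 2) - d * k + 'C(d, 2) - d]. *)
exists (3 * d)%N, (n%:Z * ('C(d, 2)%:Z - d%:Z)) => k dk.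
have [h hE hk] := Syz_h0 dk; exists h => //.
have := double_bin2 k; have := double_bin2 (k - d)%N.
have : ('C(d, 2) * 2 + d = d * d)%N.
  by case: (d) => // j; rewrite mulnC -(mul_bin_diag j.+1 1) bin1 /=; lia.
have [j kE] : exists j, k = (j + d)%N by exists (k - d)%N; lia.
move: hk; rewrite kE addnK; set A := 'C(j + d + 2, 2); set B := 'C(j + 2, 2); set C := 'C(d, 2).
move: A B C => A B C hk hC hB hA.
have BE : B%:Z = A%:Z - d%:Z * (j + d)%N%:Z + C%:Z - d%:Z by nia.
have -> : h%:Z = n%:Z * B%:Z - A%:Z by nia.
have nE : n.-1%:Z = n%:Z - 1 by lia.
by rewrite BE nE PoszM; ring.
Qed.
End HilbertSyz.

(** * The monomial ideal is primary *)

Section Ideals.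
Variables (K : closedFieldType) (n : nat) (f : 'I_n -> {mpoly K[3]}).
Implicit Types (p q : {mpoly K[3]}).

Lemma in_ideal0 : in_ideal f 0.
Proof. by exists (fun=> 0); rewrite big1 // => i _; rewrite mul0r. Qed.

Lemma in_idealD p q : in_ideal f p -> in_ideal f q -> in_ideal f (p + q).
Proof.
move=> [g ->] [h ->]; exists (fun i => g i + h i).
by rewrite -big_split /=; apply: eq_bigr => i _; rewrite mulrDl.
Qed.

Lemma in_idealMl p q : in_ideal f q -> in_ideal f (p * q).
Proof.
move=> [g ->]; exists (fun i => p * g i).
by rewrite mulr_sumr; apply: eq_bigr => i _; rewrite mulrA.
Qed.

Lemma in_ideal_gen i p : in_ideal f (p * f i).
Proof.
exists (fun j => (j == i)%:R * p); rewrite (bigD1 i) //= eqxx mul1r.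
by rewrite big1 ?addr0 // => j /negPf ->; rewrite mul0r mul0r.
Qed.

Lemma in_ideal_msupp p : (forall w, w \in msupp p -> in_ideal f 'X_[w]) -> in_ideal f p.
Proof.
move=> h; rewrite [p]mpolyE big_seq; elim/big_ind: _ => [|q r|w wp].
- exact: in_ideal0.
- exact: in_idealD.
- by rewrite -mul_mpolyC; apply/in_idealMl/h.
Qed.
End Ideals.

Section Primary.
Variables (K : closedFieldType) (n d : nat) (m : 'I_n -> 'X_{1..3}).
Hypothesis d_gt0 : (0 < d)%N.
Hypothesis m_deg : forall i, mdeg (m i) = d.
Variable vtx : 'I_3 -> 'I_n.
Hypothesis m_vtx : forall j, m (vtx j) = (U_(j) *+ d)%MM.
Local Notation f := (monomials K m).
Implicit Types (p q : {mpoly K[3]}).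

Lemma msupp_exp_deg p k w : p@_0%MM = 0 -> w \in msupp (p ^+ k) -> (k <= mdeg w)%N.
Proof.
move=> p0; elim: k w => // k IH w; rewrite exprS => /msuppM_le /allpairsP[[u v] /= [up vp ->]].
rewrite mdegD; have := IH v vp.
suff : (0 < mdeg u)%N by lia.
by rewrite lt0n mdeg_eq0; apply: contraTneq up => ->; rewrite mcoeff_msupp p0 eqxx.
Qed.

Lemma ideal_coef0 (n' : nat) (h : 'I_n' -> {mpoly K[3]}) p :
  (forall i, (h i)@_0%MM = 0) -> in_ideal h p -> p@_0%MM = 0.
Proof.
move=> h0 [g ->]; rewrite (raddf_sum (mcoeff 0%MM)) big1 // => i _.
by rewrite /= (rmorphM (mcoeff 0%MM)) /= h0 mulr0.
Qed.

Lemma monomials_coef0 i : (f i)@_0%MM = 0.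
Proof.
rewrite mcoeffX; case: eqP => // mi.
by have := m_deg i; rewrite mi mdeg0; lia.
Qed.

Lemma power_in_ideal p : p@_0%MM = 0 -> in_ideal f (p ^+ (3 * d)).
Proof.
move=> p0; apply: in_ideal_msupp => w /(msupp_exp_deg p0) dw.
have [j mw] := dvd_vertex m_vtx dw.
by rewrite -(submK mw) mpolyXD; apply: in_ideal_gen.
Qed.

Lemma in_ideal_vars p : in_ideal (fun i : 'I_3 => 'X_i) p <-> p@_0%MM = 0.
Proof.
split=> [|p0]; first by apply: ideal_coef0 => i; rewrite mcoeffX mnm1_eq0.
apply: in_ideal_msupp => w wp.
have [j wj] : exists j, w j != 0%N.
  apply/existsP; apply: contraTT wp; rewrite negb_exists => /forallP w0.
  have -> : w = 0%MM by apply/mnmP => j; rewrite mnm0E; apply/eqP; move: (w0 j); rewrite negbK.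
  by rewrite mcoeff_msupp p0 eqxx.
have jw : (U_(j) <= w)%MM by rewrite lep1mP.
by rewrite -(submK jw) mpolyXD; apply: (in_ideal_gen (fun i : 'I_3 => 'X_i)).
Qed.

(** A polynomial without constant term has its power of exponent [3 d] in the ideal. One with
    constant term [c <> 0] is a unit modulo the ideal, by the finite geometric series in
    [r = 1 - q / c]. *)
Lemma monomials_m_primary : m_primary f.
Proof.
split.
- move=> /(ideal_coef0 monomials_coef0); rewrite mcoeff1 eqxx; apply/eqP; exact: oner_neq0.
- move=> p q pq; have [q0|q0] := eqVneq (q@_0%MM) 0.
    by right; exists (3 * d)%N; apply: power_in_ideal.
  left; set c := q@_0%MM in q0; pose r := 1 - c^-1 *: q.
  have r0 : r@_0%MM = 0 by rewrite mcoeffB mcoeff1 eqxx mcoeffZ mulVf // subrr.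
  have rN := power_in_ideal r0.
  have -> : p = p * r ^+ (3 * d) + (c^-1)%:MP * (\sum_(i < 3 * d) r ^+ i) * (p * q).
    have eq1 : 1 - r ^+ (3 * d) = c^-1 *: q * \sum_(i < 3 * d) r ^+ i.
      by rewrite -opprB subrX1 -mulNr opprB /r subKr.
    have := congr1 (fun z => p * z) eq1; rewrite mulrBr mulr1 => /(canRL (subrK _)) {1}->.
    by rewrite addrC -mul_mpolyC; ring.
  by apply: in_idealD; apply: in_idealMl.
- move=> p; split=> [[k pk]|/in_ideal_vars p0].
    apply/in_ideal_vars; have := ideal_coef0 monomials_coef0 pk.
    rewrite (rmorphXn (mcoeff 0%MM)) /= => /eqP; rewrite expf_eq0 => /andP[_ /eqP //].
  by exists (3 * d)%N; apply: power_in_ideal.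
Qed.
End Primary.

(** * Ranks of column sets and the circuit induction *)

Section ColumnRanks.
Variables (K : fieldType) (n : nat).
Implicit Types (A B C : {set 'I_n}).

Definition colmask A : 'M[K]_n := diag_mx (\row_i (i \in A)%:R).

Lemma mul_colmaskE h (W : 'M[K]_(h, n)) A i j :
  (W *m colmask A) i j = W i j * (j \in A)%:R.
Proof. by rewrite mul_mx_diag !mxE. Qed.

Lemma mul_colmask h (W : 'M[K]_(h, n)) A B :
  W *m colmask A *m colmask B = W *m colmask (A :&: B).
Proof.
apply/matrixP => i j; rewrite !mul_colmaskE inE.
by case: (j \in A); case: (j \in B); rewrite ?mulr1 ?mulr0 ?mul0r.
Qed.

Definition colrk h (W : 'M[K]_(h, n)) A := \rank (W *m colmask A).

Lemma colmaskT : colmask setT = 1%:M.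
Proof. by apply/matrixP => i j; rewrite !mxE inE. Qed.

Lemma colrkS h (W : 'M[K]_(h, n)) A B : A \subset B -> (colrk W A <= colrk W B)%N.
Proof.
move=> /setIidPr AB; rewrite /colrk -AB -mul_colmask.
exact: mxrankM_maxl.
Qed.

Lemma rank_colmask_le A : (\rank (colmask A) <= #|A|)%N.
Proof.
have -> : colmask A = \sum_(i in A) delta_mx i i.
  apply/matrixP => i j; rewrite mxE summxE mxE.
  have [iA|iA] := boolP (i \in A).
    rewrite (bigD1 i) //= mxE eqxx /= big1 => [|l /andP[_ ne]]; last first.
      by rewrite mxE eq_sym (negPf ne).
    by rewrite addr0 eq_sym; case: (_ == _).
  by rewrite mul0rn big1 // => l lA; rewrite mxE (_ : i == l = false) //; apply: contraNF iA => /eqP ->.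
rewrite -sum1_card; elim/big_rec2: _ => [|i r M iA IH]; first by rewrite mxrank0.
apply: leq_trans (mxrank_add _ _) _; apply: leq_add => //.
by rewrite mxrank_delta.
Qed.

Lemma rank_colmask A : \rank (colmask A) = #|A|.
Proof.
apply/eqP; rewrite eqn_leq rank_colmask_le /=.
have : (\rank (colmask setT) <= \rank (colmask A) + \rank (colmask (~: A)))%N.
  have -> : colmask setT = colmask A + colmask (~: A).
    apply/matrixP => i j; rewrite !mxE !inE.
    by case: (i \in A); case: (i == j); rewrite ?addr0 ?add0r // ?mulr0n ?addr0.
  exact: mxrank_add.
rewrite colmaskT mxrank1 => h; rewrite -(leq_add2r #|~: A|) cardsC card_ord.
by apply: leq_trans h _; rewrite leq_add2l rank_colmask_le.
Qed.

Lemma colrk_card h (W : 'M[K]_(h, n)) A : (colrk W A <= #|A|)%N.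
Proof. by rewrite -(rank_colmask A); apply: mxrankM_maxr. Qed.

(** Rank and nullity for the projection to [C]: the image of the [A]-part of [W] has rank
    [colrk W (A :&: C)], and the kernel contains what comes from vectors of [W] vanishing on [C]. *)
Lemma colrk_split h (W : 'M[K]_(h, n)) A C :
  (colrk W (A :&: C) + colrk (W :&: kermx (colmask C))%MS A <= colrk W A)%N.
Proof.
rewrite /colrk -(mxrank_mul_ker (W *m colmask A) (colmask C)) mul_colmask leq_add2l.
apply: mxrankS; rewrite sub_capmx submxMr ?capmxSl //=.
apply/sub_kermxP; have /sub_kermxP ker := capmxSr W (kermx (colmask C)).
by rewrite mul_colmask setIC -mul_colmask ker mul0mx.
Qed.

Lemma rank_split h (W : 'M[K]_(h, n)) C :
  (colrk W C + \rank (W :&: kermx (colmask C))%MS = \rank W)%N.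
Proof. exact: mxrank_mul_ker. Qed.

(* A circuit of the matroid of the columns of W; the columns are dependent
   because the rows sum to zero. *)
Lemma circuit h (W : 'M[K]_(h, n)) : W != 0 -> W *m const_mx 1 = 0 :> 'cV_h ->
  exists C : {set 'I_n}, [/\ (2 <= #|C|)%N, colrk W C = #|C|.-1 &
    forall A, A \proper C -> colrk W A = #|A|].
Proof.
(* Zero columns are discarded, since they would be circuits with a single element. *)
move=> W0 W1; pose S := [set i | colrk W [set i] != 0%N].
have WS : W *m colmask S = W.
  apply/matrixP => i j; rewrite mul_colmaskE inE.
  have [/eqP|] := eqVneq (colrk W [set j]) 0%N; last by rewrite mulr1.
  rewrite mxrank_eq0 => /eqP/matrixP/(_ i j); rewrite mul_colmaskE set11 mulr1 mxE => ->.
  by rewrite mul0r.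
have S0 : S != set0.
  apply: contraNneq W0 => S0; rewrite -WS S0; apply/eqP/matrixP => i j.
  by rewrite mul_colmaskE inE mulr0 mxE.
(* The sum of coordinates vanishes on [W] but not on the whole coordinate space of [S]. *)
have depS : (colrk W S < #|S|)%N.
  have [i0 i0S] := set0Pn _ S0.
  rewrite -(rank_colmask S) -(mxrank_mul_ker (colmask S) (const_mx 1 : 'cV_n)).
  have -> : \rank (colmask S *m (const_mx 1 : 'cV[K]_n)) = 1%N.
    apply/eqP; rewrite eqn_leq rank_leq_col lt0n mxrank_eq0.
    apply: contraTneq i0S => /matrixP/(_ i0 0); rewrite mul_diag_mx !mxE mulr1.
    by case: (i0 \in S) => // /eqP; rewrite oner_eq0.
  rewrite add1n ltnS; apply: mxrankS; rewrite sub_capmx submxMl /=.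
  by apply/sub_kermxP; rewrite WS.
pose dep A := (colrk W A < #|A|)%N && (A \subset S).
have [C /minsetP[/andP[depC CS] minC] _] := @minset_exists _ dep S (introT andP (conj depS (subxx S))).
have indep A : A \proper C -> colrk W A = #|A|.
  move=> pA; apply/eqP; rewrite eqn_leq colrk_card /= leqNgt; apply/negP => lt.
  have [sA neA] := properP pA; have /minC : dep A by rewrite /dep lt (subset_trans sA).
  by move=> /(_ sA) AeqC; move: pA; rewrite AeqC properxx.
have [i iC] : exists i, i \in C.
  by apply/set0Pn; apply: contraTneq depC => ->; rewrite cards0.
have iS : colrk W [set i] != 0%N by move: (subsetP CS i iC); rewrite inE.
have cC : #|C| = #|C :\ i|.+1 by rewrite (cardsD1 i) iC.
have rkC : colrk W C = #|C|.-1.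
  apply/eqP; rewrite eqn_leq; apply/andP; split; first by lia.
  rewrite cC /= -(indep (C :\ i)) ?properD1 //.
  exact/colrkS/subsetDl.
exists C; split=> //; rewrite ltnNge; apply/negP => le1.
have C1 : C = [set i].
  by apply/esym/eqP; rewrite eqEcard sub1set iC cards1.
by move: iS; rewrite -C1 rkC C1 cards1.
Qed.
End ColumnRanks.

Section Filtration.
Variables (K : fieldType) (n d : nat) (a : 'I_n -> 'I_3 -> nat).
Hypothesis a_deg : forall i, (\sum_j a i j = d)%N.
Variable delta : nat.
Hypothesis crit : forall (C : {set 'I_n}) (e : 'I_3 -> nat),
  (2 <= #|C| < n)%N -> (forall i j, i \in C -> (e j <= a i j)%N) ->
  (d * #|C|.-1 + delta <= n.-1 * (d - \sum_j e j))%N.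

Definition level j t : {set 'I_n} := [set i | (t < a i j)%N].

(* Minus the first Chern class of the equivariant sheaf given by the row space
   of W and the filtrations by the exponents of the monomials. *)
Definition phi h (W : 'M[K]_(h, n)) : nat :=
  (\sum_(j < 3) \sum_(t < d) colrk W (level j t))%N.

Lemma sum_ltn b l : (l <= b)%N -> (\sum_(t < b) (t < l) = l)%N.
Proof.
suff -> : (\sum_(t < b) (t < l) = minn l b)%N by lia.
elim: b => [|b IH]; first by rewrite big_ord0 minn0.
by rewrite big_ord_recr /= IH; lia.
Qed.

Lemma a_le i j : (a i j <= d)%N.
Proof. by rewrite -(a_deg i) (bigD1 j) //= leq_addr. Qed.

(** The numerical point is that [crit] gives [n.-1 * (d * #|C| - \sum_j e j) >= n * d * #|C|.-1 +
    delta], while splitting off the circuit [C] lowers the rank by [#|C|.-1]. *)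
Lemma phi_ge h (W : 'M[K]_(h, n)) : W *m const_mx 1 = 0 :> 'cV_h ->
  (\rank W < n.-1)%N ->
  (n * d * \rank W + (0 < \rank W) * delta <= n.-1 * phi W)%N.
Proof.
have [r] := ubnP (\rank W); elim: r h W => // r IH h W ltr W1 rkn.
have [rk0|rk_gt0] := posnP (\rank W); first by rewrite rk0 muln0 mul0n.
have W0 : W != 0 by rewrite -mxrank_eq0 -lt0n.
have [C [C2 rkC indep]] := circuit W0 W1.
set W' := (W :&: kermx (colmask K C))%MS.
have rkW := rank_split W C; rewrite -/W' rkC in rkW.
have W'1 : W' *m const_mx 1 = 0 :> 'cV_n.
  have /submxP[D ->] : (W' <= W)%MS by apply: capmxSl.
  by rewrite -mulmxA W1 mulmx0.
have /IH -/(_ W'1) : (\rank W' < r)%N by lia.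
have rkn' : (\rank W' < n.-1)%N by lia.
move=> /(_ rkn') IHW.
(* [e j] is the least [j]-th exponent over [C], that is the exponent of [X_j] in the gcd. *)
pose e j := (\sum_(t < d) (C \subset level j t))%N.
have eE i j : i \in C -> (e j <= a i j)%N.
  move=> iC; rewrite -[X in (_ <= X)%N](sum_ltn (a_le i j)); apply: leq_sum => t _.
  have [/subsetP/(_ i iC)|] := boolP (C \subset level j t) => //.
  by rewrite inE => ->.
have eC : (\sum_j e j <= d)%N.
  have [i iC] : exists i, i \in C by apply/set0Pn; rewrite -card_gt0; lia.
  by rewrite -(a_deg i); apply: leq_sum => j _; apply: eE.
have cC : (2 <= #|C| < n)%N by lia.
have := crit cC eE.
(* A level set meets [C] in an independent set unless it contains [C]; in that case one is lost, and
   [e] counts these losses. *)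
have phiC : (\sum_(j < 3) \sum_(t < d) colrk W (level j t :&: C) + \sum_j e j = d * #|C|)%N.
  rewrite -big_split /=.
  transitivity (\sum_(j < 3) \sum_(t < d) #|level j t :&: C|)%N.
    apply: eq_bigr => j _; rewrite -big_split /=; apply: eq_bigr => t _.
    have [sub|nsub] := boolP (C \subset level j t).
      by rewrite (setIidPr sub) rkC addn1 prednK //; lia.
    rewrite addn0 indep // properE subsetIr /=.
    by apply: contra nsub => /subset_trans; apply; apply: subsetIl.
  transitivity (\sum_(j < 3) \sum_(t < d) \sum_(i in C) (t < a i j))%N.
    apply: eq_bigr => j _; apply: eq_bigr => t _.
    rewrite -sum1_card big_mkcond [RHS]big_mkcond /=; apply: eq_bigr => i _.
    by rewrite !inE andbC; case: (i \in C); case: (t < _)%N.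
  under eq_bigr => j _ do rewrite exchange_big /=.
  rewrite exchange_big /= mulnC -sum_nat_const; apply: eq_bigr => i _.
  rewrite -(a_deg i); by apply: eq_bigr => j _; rewrite sum_ltn // a_deg a_le.
have phi_split : (\sum_(j < 3) \sum_(t < d) colrk W (level j t :&: C) + phi W' <= phi W)%N.
  rewrite /phi -big_split /=; apply: leq_sum => j _.
  by rewrite -big_split /=; apply: leq_sum => t _; apply: colrk_split.
move: phi_split IHW phiC eC rkW cC rk_gt0; clear.
set s := (\sum_(j < 3) \sum_(t < d) colrk W _)%N; move: s (phi W) (phi W') (\sum_j e j)%N (\rank W) (\rank W') #|C|.
move=> s p p' E rW rW' c hp ih hs hE hr hc _; rewrite mul1n => hcrit.
have [c1 cE] : exists c1, c = c1.+1 by exists c.-1; lia.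
have [n1 nE] : exists n1, n = n1.+1 by exists n.-1; lia.
subst c; rewrite /= in hr hcrit; have [D DE] : exists D, (D + E = d)%N by exists (d - E)%N; lia.
have sE : s = (d * c1 + D)%N by lia.
move: hp ih hcrit; rewrite sE -hr nE /= (_ : d - E = D)%N; last by lia.
move=> hp ih hcrit.
have := leq_mul (leqnn n1) hp; nia.
Qed.
End Filtration.

(** * Degeneration to a torus-equivariant subsheaf *)

Section Monomials3.

Definition mons (k : nat) : seq 'X_{1..3} :=
  sort (fun u v => (v <= u)%O) [seq s2m (val t) | t <- enum (basis 3 k)].

Lemma mem_mons k u : (u \in mons k) = (mdeg u == k).
Proof. by rewrite mem_sort -basis_cover. Qed.

Lemma mons_uniq k : uniq (mons k).
Proof. by rewrite sort_uniq uniq_basis. Qed.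

Lemma size_mons k : size (mons k) = 'C(k + 2, 2).
Proof. by rewrite size_sort size_basis -(@bin_sub (k + 2) 2) ?addnK // leq_addl. Qed.

Lemma mons_sorted k : sorted (fun u v => (v < u)%O) (mons k).
Proof.
have le_tot : total (fun u v : 'X_{1..3} => (v <= u)%O) by move=> u v; apply: le_total.
have := sort_sorted le_tot [seq s2m (val t) | t <- enum (basis 3 k)].
rewrite -/(mons k) => srt; have gt_tr : transitive (fun u v : 'X_{1..3} => (v < u)%O).
  by move=> u v w uv vw; apply: lt_trans vw uv.
have ge_tr : transitive (fun u v : 'X_{1..3} => (v <= u)%O).
  by move=> u v w uv vw; apply: le_trans vw uv.
move: srt (mons_uniq k); rewrite sorted_pairwise // sorted_pairwise //.
elim: (mons k) => //= u s IH /andP[/allP us ps] /andP[nu un]; rewrite IH // andbT.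
apply/allP => v vs; rewrite lt_neqAle us // andbT.
by apply: contraNneq nu => <-.
Qed.

Lemma mem_take_mons k u v : u \in mons k ->
  (v \in take (index u (mons k)) (mons k)) = (v \in mons k) && (u < v)%O.
Proof.
have gt_tr : transitive (fun u v : 'X_{1..3} => (v < u)%O).
  by move=> x y z xy yz; apply: lt_trans yz xy.
move=> us; have := mons_sorted k; rewrite sorted_pairwise //.
have sE := cat_take_drop (index u (mons k)) (mons k).
have dE : drop (index u (mons k)) (mons k) = u :: drop (index u (mons k)).+1 (mons k).
  by rewrite (drop_nth u) ?index_mem // nth_index.
move: sE dE; set s1 := take _ _; set s2 := drop _ _; move: s1 s2 => s1 s2 sE dE.
rewrite -sE dE pairwise_cat /= => /and3P[/allrelP gt12 _ /andP[/allP gtu _]].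
rewrite mem_cat inE; have [v1|v1] /= := boolP (v \in s1).
  by rewrite gt12 // inE eqxx.
have [->|ne] /= := eqVneq v u; first by rewrite ltxx.
by apply/esym/andP => -[/gtu lt1 lt2]; have := lt_trans lt1 lt2; rewrite ltxx.
Qed.
End Monomials3.

Lemma leq_sum_inj (X : finType) (T : eqType) (P : X -> T) (s : seq T) (f : T -> nat) :
  injective P -> uniq s -> (forall x, P x \in s) ->
  (\sum_x f (P x) <= \sum_(u <- s) f u)%N.
Proof.
move=> injP us Ps; rewrite -(big_map P xpredT f) /=.
have un : uniq (map P (index_enum X)) by rewrite map_inj_uniq ?index_enum_uniq.
rewrite [X in (_ <= X)%N](bigID (mem (map P (index_enum X)))) /= -[X in (X <= _)%N]addn0; apply: leq_add => //.
rewrite -[X in (_ <= X)%N]big_filter.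
rewrite [X in (_ <= X)%N](perm_big (map P (index_enum X))) //.
apply: uniq_perm => //; first exact: filter_uniq.
move=> u; rewrite mem_filter /=; case: mapP => // -[x _ ->]; exact: Ps.
Qed.

Section RankFlag.
Variables (K : fieldType) (h n : nat) (T : eqType) (A : T -> 'M[K]_(h, n)).

Definition common_ker (s : seq T) : 'M[K]_h := (\bigcap_(u <- s) kermx (A u))%MS.

Lemma common_kerP s (c : 'rV[K]_h) :
  reflect (forall u, u \in s -> c *m A u = 0) (c <= common_ker s)%MS.
Proof.
rewrite /common_ker; elim: s => [|u s IH].
  by rewrite big_nil submx1; constructor.
rewrite big_cons sub_capmx; apply: (iffP andP) => [[/sub_kermxP cu /IH cs] v|cs].
  by rewrite inE => /orP[/eqP ->|/cs].
split; first by apply/sub_kermxP/cs; rewrite inE eqxx.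
by apply/IH => v vs; apply: cs; rewrite inE vs orbT.
Qed.

(* When s is sorted decreasingly, the row space consists of the values at u of
   the combinations that vanish at all larger indices. *)
Definition initial_mx (s : seq T) (u : T) : 'M[K]_n :=
  <<common_ker (take (index u s) s) *m A u>>%MS.

Lemma initial_mxP s u (v : 'rV[K]_n) :
  (v <= initial_mx s u)%MS <->
  exists c : 'rV[K]_h, c *m A u = v /\ forall w, w \in take (index u s) s -> c *m A w = 0.
Proof.
rewrite /initial_mx genmxE; split=> [/submxP[D ->]|[c [<- cs]]].
  exists (D *m common_ker (take (index u s) s)); split; first by rewrite mulmxA.
  by apply/common_kerP; apply: submxMl.
by apply: submxMr; apply/common_kerP.
Qed.

(** Appending [u] shrinks the common kernel by the rank of its image under [A u]; the sum telescopes
    from the full space of dimension [h]. *)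
Lemma rank_flag s : uniq s ->
  (\sum_(u <- s) \rank (initial_mx s u) + \rank (common_ker s) = h)%N.
Proof.
elim/last_ind: s => [|s u IH]; first by rewrite big_nil /common_ker big_nil mxrank1.
rewrite rcons_uniq => /andP[us uns].
rewrite -cats1 big_cat /= big_seq1 -addnA.
have -> : initial_mx (s ++ [:: u]) u = <<common_ker s *m A u>>%MS.
  by rewrite /initial_mx index_cat (negPf us) /= eqxx addn0 take_size_cat.
rewrite genmxE; have -> : \rank (common_ker (s ++ [:: u])) = \rank (common_ker s :&: kermx (A u))%MS.
  by rewrite /common_ker big_cat /= big_seq1.
rewrite mxrank_mul_ker -[RHS](IH uns); congr addn.
apply: eq_big_seq => v vs; rewrite /initial_mx index_cat vs.
by rewrite take_cat index_mem vs.
Qed.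
End RankFlag.

Lemma ex_maximal (P : nat -> Prop) (b x : nat) : P x -> (forall y, P y -> (y <= b)%N) ->
  exists2 y, P y & forall z, P z -> (z <= y)%N.
Proof.
move=> Px Pb; have [k] := ubnP (b - x); elim: k x Px => // k IH x Px ltk.
have [[y [Py lt]]|no] := classic (exists y, P y /\ (x < y)%N).
  by apply: (IH y Py); have := Pb y Py; lia.
by exists x => // z Pz; rewrite leqNgt; apply/negP => lt; apply: no; exists z.
Qed.

Section Degeneration.
Variables (K : fieldType) (n d : nat) (m : 'I_n -> 'X_{1..3}).
Variables (init : 'X_{1..3} -> 'rV[K]_n -> Prop) (k1 : nat) (hilb : nat -> nat).
Hypothesis init_mx : forall k, (k1 <= k)%N -> exists I : 'X_{1..3} -> 'M[K]_n,
  (forall u v, mdeg u = k -> (v <= I u)%MS <-> init u v) /\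
  (\sum_(u <- mons k) \rank (I u) = hilb k)%N.
Hypothesis init_mono : forall u w v, (k1 <= mdeg u)%N -> init u v -> init (u + w)%MM v.
Hypothesis init_supp : forall u v i, init u v -> ~~ (m i <= u)%MM -> v 0 i = 0.
Hypothesis init_sum : forall u v, (k1 <= mdeg u)%N -> init u v -> v *m const_mx 1 = 0 :> 'cV_1.

Local Notation lev := (level (fun i j => m i j)).
Local Notation phiW := (phi d (fun i j => m i j)).

(* The exponents with i-th entry < d for i = x.1 only; these contribute the
   linear term of the Hilbert function. *)
Definition slab k (x : 'I_3 * ('I_d * 'I_(k - 3 * d))) : 'X_{1..3} :=
  [multinom (if i == x.1 then x.2.1 : nat else if i == (x.1 + 1)%R then (d + x.2.2)%N
     else (k - x.2.1 - d - x.2.2)%N) | i < 3].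

Lemma slab_mons k x : @slab k x \in mons k.
Proof.
case: x => j [t s]; rewrite mem_mons mdegE; apply/eqP.
rewrite !big_ord_recl big_ord0 !mnmE /=.
have := ltn_ord t; have := ltn_ord s.
by case: j => [[|[|[|j]]] lj] //=; lia.
Qed.

Lemma slab_small k j t s (i : 'I_3) : (@slab k (j, (t, s)) i < d)%N = (i == j).
Proof.
rewrite mnmE /=; case: eqP => [_|_]; first by rewrite ltn_ord.
have := ltn_ord t; have := ltn_ord s.
by case: ifP => _; lia.
Qed.

Lemma slab_at k j t s : @slab k (j, (t, s)) j = t.
Proof. by rewrite mnmE /= eqxx. Qed.

Lemma slab_inj k : injective (@slab k).
Proof.
move=> [j [t s]] [j' [t' s']] eq_s.
have jj' : j = j'.
  by apply/eqP; rewrite -(slab_small j' t' s') -eq_s slab_small.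
subst j'; have tt' : t = t' by apply: val_inj; rewrite /= -(slab_at j t s) eq_s slab_at.
have := congr1 (fun u : 'X_{1..3} => u (j + 1)) eq_s; rewrite !mnmE /= tt' !eqxx.
have -> : j + 1 == j = false by rewrite -subr_eq0 addrC addKr.
by move=> /addnI/val_inj ->.
Qed.

Lemma slab_sum (k : nat) (W : 'M[K]_n) (val : 'X_{1..3} -> nat) :
  (forall (u : 'X_{1..3}) j, (colrk W (lev j (u j)) <= val u)%N) ->
  ((k - 3 * d) * phiW W <= \sum_(u <- mons k) val u)%N.
Proof.
move=> le_val.
apply: leq_trans (leq_sum_inj _ (@slab_inj k) (mons_uniq k) (@slab_mons k)).
rewrite -(pair_big xpredT xpredT (fun j (y : 'I_d * 'I_(k - 3 * d)) => val (slab (j, y)))) /=.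
rewrite /phi big_distrr /=; apply: leq_sum => j _.
rewrite -(pair_big xpredT xpredT (fun t s => val (slab (j, (t, s))))) /=.
rewrite big_distrr /=; apply: leq_sum => t _.
rewrite -[X in (X * _)%N]card_ord -sum_nat_const; apply: leq_sum => s _.
by have := le_val (slab (j, (t, s))) j; rewrite slab_at.
Qed.

Lemma row_space_sub (M N : 'M[K]_n) :
  (forall v : 'rV_n, (v <= M)%MS -> (v <= N)%MS) -> (M <= N)%MS.
Proof. by move=> MN; apply/row_subP => i; apply/MN/row_sub. Qed.

(** [W] is an initial space of maximal dimension. Those at [u0] and [u] both lie in the one at
    [u0 + u], so [W] contains them all, and equality above [u0] gives the lower bound. For the upper
    bound, a vector at [u] vanishes on the coordinates whose monomial does not divide [X^u], which
    costs their rank on [W]. *)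
Lemma degeneration : exists (W : 'M[K]_n) (k2 : nat), W *m const_mx 1 = 0 :> 'cV_n /\
  forall k, (k2 <= k)%N ->
    (hilb k + (k - 3 * d) * phiW W <= \rank W * 'C(k + 2, 2))%N /\
    (\rank W * 'C(k - k2 + 2, 2) <= hilb k)%N.
Proof.
pose reps u (M : 'M[K]_n) := (k1 <= mdeg u)%N /\ forall v, (v <= M)%MS <-> init u v.
have reps_ex u : (k1 <= mdeg u)%N -> exists M, reps u M.
  by move=> ku; have [I [IP _]] := init_mx ku; exists (I u); split=> // v; apply: IP.
have [u1 du1] : exists u : 'X_{1..3}, mdeg u = k1.
  by exists (U_(ord0) *+ k1)%MM; rewrite mdegMn mdeg1 mul1n.
have [M1 M1P] : exists M, reps u1 M by apply: reps_ex; rewrite du1.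
have [_ [u0 [W [[ku0 WP] <-]]] maxW] :=
  @ex_maximal (fun r => exists u M, reps u M /\ \rank M = r) n (\rank M1)
    (ex_intro _ u1 (ex_intro _ M1 (conj M1P erefl)))
    (fun r '(ex_intro u (ex_intro M (conj _ rM))) => eq_ind _ (fun r => r <= n)%N (rank_leq_row M) _ rM).
have init_W u v : (k1 <= mdeg u)%N -> init u v -> (v <= W)%MS.
  move=> ku uv; have ku' : (k1 <= mdeg (u0 + u)%MM)%N by rewrite mdegD; lia.
  have [M [_ MP]] := reps_ex _ ku'.
  have WM : (W <= M)%MS.
    by apply: row_space_sub => w /WP/(init_mono u ku0)/MP.
  have MW : (M <= W)%MS.
    rewrite -(mxrank_leqif_sup WM) eqn_leq mxrankS //=.
    by apply: maxW; exists (u0 + u)%MM, M.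
  by apply: submx_trans MW; apply/MP; rewrite addmC; apply: init_mono.
exists W, (mdeg u0); split.
  apply/row_matrixP => i; rewrite row_mul row0; apply: (@init_sum u0 _ ku0).
  by apply/WP/row_sub.
move=> k ku0'; have kk1 : (k1 <= k)%N by lia.
have [I [IP IE]] := init_mx kk1; split; last first.
  pose s := mons (k - mdeg u0); pose P (x : 'I_(size s)) := (u0 + nth 0 s x)%MM.
  have dP x : mdeg (P x) = k.
    have := mem_nth 0%MM (ltn_ord x); rewrite mem_mons => /eqP ds.
    by rewrite mdegD ds; lia.
  have injP : injective P.
    move=> x y /addmI/eqP; rewrite nth_uniq ?mons_uniq // => /eqP; exact: val_inj.
  rewrite -IE; apply: leq_trans (leq_sum_inj _ injP (mons_uniq k) _); last first.
    by move=> x; rewrite mem_mons dP.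
  rewrite -size_mons mulnC -[X in (X * _)%N]card_ord -sum_nat_const; apply: leq_sum => x _.
  apply: mxrankS; apply: row_space_sub => v /WP wv.
  by apply/IP; rewrite ?dP //; apply: init_mono.
pose C u : {set 'I_n} := [set i | ~~ (m i <= u)%MM].
have Cle (u : 'X_{1..3}) j : (colrk W (lev j (u j)) <= colrk W (C u))%N.
  apply/colrkS/subsetP => i; rewrite !inE => lt.
  by apply/negP => /mnm_lepP/(_ j); rewrite leqNgt lt.
rewrite -IE; apply: leq_trans (leq_add (leqnn _) (slab_sum k Cle)) _.
rewrite -big_split /= -size_mons mulnC -sum1_size big_distrl /=.
rewrite big_seq [X in (_ <= X)%N]big_seq; apply: leq_sum => u; rewrite mem_mons mul1n => /eqP du.
rewrite -(rank_split W (C u)) addnC leq_add2l; apply: mxrankS.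
apply: row_space_sub => v /(IP _ _ du) uv; rewrite sub_capmx (init_W u) ?du //=.
apply/sub_kermxP/rowP => i; rewrite mul_colmaskE mxE inE.
by have [|nle] := boolP (m i <= u)%MM; rewrite ?mulr0 // (init_supp uv) // mul0r.
Qed.
End Degeneration.

Lemma sqr_gt_affine (P Q j : nat) : (P + Q < j)%N -> (P * j + Q < j * j)%N.
Proof.
move=> h; have : ((P + Q + 1) * j <= j * j)%N by rewrite leq_mul2r; lia.
by have : (Q <= Q * j)%N by [rewrite leq_pmulr //; lia]; lia.
Qed.

(** The quadratic terms force [w = r], the shift by [k2] being of lower order; then the linear terms
    give [c <= - p]. Each step is a contradiction at one explicit large [k]. *)
Lemma hilbert_compare (hilb : nat -> nat) (r w k0 k2 e p : nat) (c a : int) :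
  (forall k, (k0 <= k)%N -> (hilb k)%:Z = r%:Z * 'C(k + 2, 2)%:Z + c * k%:Z + a) ->
  (forall k, (k2 <= k)%N -> (hilb k + (k - e) * p <= w * 'C(k + 2, 2))%N) ->
  (forall k, (k2 <= k)%N -> (w * 'C(k - k2 + 2, 2) <= hilb k)%N) ->
  w = r /\ c <= - p%:Z.
Proof.
move=> hE up lo; have le_abs (z : int) : - (absz z)%:Z <= z <= (absz z)%:Z by lia.
set ca := absz c; set aa := absz a.
have mul_abs k : - (ca * k)%N%:Z <= c * k%:Z <= (ca * k)%N%:Z.
  by have := le_abs c; rewrite -/ca; nia.
have ha := le_abs a; rewrite -/aa in ha.
have wr : (w <= r)%N.
  rewrite leqNgt; apply/negP => lt.
  (* [P * j + Q] is twice the total error in the case [r < w], written in terms of [j = k - k2]. *)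
  pose P := (2 * (r * k2) + 2 * ca)%N.
  pose Q := (r * (k2 * (3 + k2)) + 2 * (ca * k2) + 2 * aa)%N.
  pose j := (P + Q + k0 + 1)%N; pose k := (j + k2)%N.
  have hPQ : (P * j + Q < j * j)%N by apply: sqr_gt_affine; lia.
  have := lo k (leq_addl _ _); have := hE k; rewrite addnK.
  have := double_bin2 j; have := double_bin2 k; have := mul_abs k.
  have kE : k = (j + k2)%N by [].
  have k0k : (k0 <= k)%N by lia.
  set T := 'C(k + 2, 2); set S := 'C(j + 2, 2) => hc hT hS /(_ k0k) hk hw.
  have {hw}h1 : (w * S <= r * T + ca * k + aa)%N by lia.
  have h2 : (w * (S * 2) <= r * (T * 2) + 2 * (ca * k) + 2 * aa)%N by lia.
  rewrite hS hT in h2.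
  have h3 : ((r + 1) * ((j + 2) * (j + 1)) <= w * ((j + 2) * (j + 1)))%N.
    by rewrite leq_mul2r; apply/orP; right; lia.
  have h4 : ((k + 2) * (k + 1) = (j + 2) * (j + 1) + k2 * (2 * j + 3 + k2))%N.
    by rewrite kE; ring.
  have h5 : (r * ((k + 2) * (k + 1)) = r * ((j + 2) * (j + 1)) + (2 * (r * k2) * j + r * (k2 * (3 + k2))))%N.
    by rewrite h4; ring.
  have h6 : (ca * k = ca * j + ca * k2)%N by rewrite kE; ring.
  have h7 : ((j + 2) * (j + 1) = j * j + 3 * j + 2)%N by ring.
  have h8 : (P * j = 2 * (r * k2) * j + 2 * (ca * j))%N by rewrite /P; ring.
  by rewrite h5 h6 in h2; rewrite h8 /Q in hPQ; lia.
have rw : (r <= w)%N.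
  rewrite leqNgt; apply/negP => lt.
  pose k := (2 * ca + 2 * aa + k0 + k2 + 1)%N.
  have hPQ : (2 * ca * k + 2 * aa < k * k)%N by apply: sqr_gt_affine; lia.
  have k2k : (k2 <= k)%N by lia.
  have k0k : (k0 <= k)%N by lia.
  have := up k k2k; have := hE k k0k; have := double_bin2 k; have := mul_abs k.
  set T := 'C(k + 2, 2) => hc hT hk hw.
  have h1 : (r * T <= w * T + ca * k + aa)%N by lia.
  have h2 : ((w + 1) * T <= r * T)%N by rewrite leq_mul2r; apply/orP; right; lia.
  have h3 : ((k + 2) * (k + 1) = k * k + 3 * k + 2)%N by ring.
  by lia.
have {rw}wr : w = r by apply/eqP; rewrite eqn_leq wr.
subst w; split=> //; rewrite leNgt; apply/negP => lt.
pose k := (e * p + aa + k0 + k2 + e + 1)%N.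
have k2k : (k2 <= k)%N by lia.
have k0k : (k0 <= k)%N by lia.
have := up k k2k; have := hE k k0k; set T := 'C(k + 2, 2) => hk hw.
have kp : ((k - e) * p = k * p - e * p)%N by rewrite mulnBl.
have ep : (e * p <= k * p)%N by rewrite leq_mul2r; lia.
have h1 : c * k%:Z + a + (k * p)%N%:Z <= (e * p)%N%:Z by lia.
have h2 : (1 - p%:Z) * k%:Z <= c * k%:Z.
  by apply: ler_wpM2r; lia.
have h3 : (1 - p%:Z) * k%:Z = k%:Z - (k * p)%N%:Z by rewrite PoszM; ring.
by lia.
Qed.

(** * Initial spaces of a subsheaf and the bound on its Chern class *)

Section SubsheafBound.
Variables (K : closedFieldType) (n d : nat) (m : 'I_n -> 'X_{1..3}).
Hypothesis m_deg : forall i, mdeg (m i) = d.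
Local Notation f := (monomials K m).
Local Notation E := (Syz d f).
Variable F : sections K n.
Hypothesis sF : subsheaf (- d%:Z) F.
Hypothesis FE : sub_sections F E.
Implicit Types (g : 'I_n -> {mpoly K[3]}) (u : 'X_{1..3}) (v : 'rV[K]_n).

Definition global_tuple k g : Prop :=
  (forall i, g i \is (k - d).-homog) /\ twist (- d%:Z) F k%:Z (@P2 K) (poly_row g).

(* Multiplying g_i by X^(m i) makes the fine grading of O(-d)^n visible, and
   turns syzygies into tuples whose components sum to zero. *)
Definition fine_coef g u : 'rV[K]_n := \row_i ('X_[m i] * g i)@_u.

Definition initial u v : Prop := exists g,
  [/\ global_tuple (mdeg u) g, fine_coef g u = v &
      forall w, mdeg w = mdeg u -> (u < w)%O -> fine_coef g w = 0].

Lemma poly_row_inj g g' : (forall x, x != 0 -> poly_row g x = poly_row g' x) ->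
  forall i, g i = g' i.
Proof.
by move=> h i; apply: mpoly_ev_inj => x /h/rowP/(_ i); rewrite !mxE.
Qed.

Lemma poly_row_comb h (G : 'I_h -> 'I_n -> {mpoly K[3]}) (c : 'I_h -> K) x :
  poly_row (fun i => \sum_j c j *: G j i) x = \sum_j c j *: poly_row (G j) x.
Proof.
apply/rowP => i; rewrite summxE !mxE ev_sum.
by apply: eq_bigr => j _; rewrite !mxE evZ.
Qed.

Lemma global_tuple_comb h k (G : 'I_h -> 'I_n -> {mpoly K[3]}) (c : 'I_h -> K) :
  (forall j, global_tuple k (G j)) -> global_tuple k (fun i => \sum_j c j *: G j i).
Proof.
move=> hG; split=> [i|].
  by apply: rpred_sum => j _; apply: dhomogZ; case: (hG j).
apply: (twist_ext sF (fun x _ => poly_row_comb G c x)).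
elim: (index_enum _) => [|j s IH].
  by apply: (twist_ext sF _ (twist0 k sF)) => x _; rewrite big_nil.
apply: (twist_ext sF _ (twistD sF (twistZ (c j) sF (proj2 (hG j))) IH)) => x _.
by rewrite big_cons.
Qed.

Lemma global_tupleMX k g (j : 'I_3) : (d <= k)%N -> global_tuple k g ->
  global_tuple k.+1 (fun i => 'X_j * g i).
Proof.
move=> dk [hg tg]; split=> [i|].
  have := dhomogM (@dhomogXUn K j 1) (hg i); rewrite expr1.
  by rewrite (_ : 1 + (k - d) = k.+1 - d)%N //; lia.
apply: (twist_ext sF _ (twistMX j sF tg)) => x _.
by apply/rowP => i; rewrite !mxE evM evXU.
Qed.

Lemma fine_coefMX g j u : fine_coef (fun i => 'X_j * g i) (u + U_(j))%MM = fine_coef g u.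
Proof.
by apply/rowP => i; rewrite !mxE mulrCA mulrC addmC mcoeffMX.
Qed.

Lemma fine_coefMX_eq0 g j (w : 'X_{1..3}) : w j = 0%N -> fine_coef (fun i => 'X_j * g i) w = 0.
Proof.
move=> wj; apply/rowP => i; rewrite !mxE mulrCA mulrC.
apply/eqP; rewrite mcoeff_eq0 (perm_mem (msuppMX _ _)); apply/negP => /mapP.
by case=> u _ wE; move: wj; rewrite wE mnmDE mnm1E eqxx.
Qed.

(** The monomial order is invariant under adding an exponent, and monomials not divisible by [X_j]
    do not occur in a multiple of [X_j]. *)
Lemma initialMX u j v : (d <= mdeg u)%N -> initial u v -> initial (u + U_(j))%MM v.
Proof.
move=> du [g [hg gu gw]]; have dE : mdeg (u + U_(j))%MM = (mdeg u).+1 by rewrite mdegD mdeg1 addn1.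
exists (fun i => 'X_j * g i); rewrite dE; split.
- exact: global_tupleMX.
- by rewrite fine_coefMX.
- move=> w dw lt_w; have [wj|wj] := eqVneq (w j) 0%N; first exact: fine_coefMX_eq0.
  have wE : w = (w - U_(j) + U_(j))%MM by rewrite submK // lep1mP.
  rewrite wE fine_coefMX; apply: gw.
    by have := congr1 (@mdeg 3) wE; rewrite mdegD mdeg1 dw; lia.
  by move: lt_w; rewrite {1}wE ltmc_add2l.
Qed.

Lemma initial_mono u w v : (d <= mdeg u)%N -> initial u v -> initial (u + w)%MM v.
Proof.
have [l] := ubnP (mdeg w); elim: l u w => // l IH u w lt_w du uv.
have [/eqP|/eqP w0] := eqVneq (mdeg w) 0%N; first by rewrite mdeg_eq0 => /eqP ->; rewrite addm0.
have [j wj] : exists j, w j != 0%N.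
  apply/existsP; apply: contra_notT w0; rewrite negb_exists => /forallP w0.
  by rewrite mdegE big1 // => j _; apply/eqP; move: (w0 j); rewrite negbK.
have wE : w = (U_(j) + (w - U_(j)))%MM by rewrite addmC submK // lep1mP.
have dw : (mdeg w = 1 + mdeg (w - U_(j)))%N by rewrite {1}wE mdegD mdeg1.
rewrite wE addmA; apply: IH; first by lia.
  by rewrite mdegD; lia.
exact: initialMX.
Qed.

Lemma global_tuple_syz k g : (d <= k)%N -> global_tuple k g -> \sum_i f i * g i = 0.
Proof.
move=> dk [hg tg].
have [g' [_ gg' fg']] := twist_poly FE dk tg; rewrite -[RHS]fg'.
by apply: eq_bigr => i _; rewrite (poly_row_inj gg').
Qed.

Lemma initial_sum u v : (d <= mdeg u)%N -> initial u v -> v *m const_mx 1 = 0 :> 'cV_1.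
Proof.
move=> du [g [hg <- _]]; apply/rowP => l; rewrite !mxE.
transitivity ((\sum_i f i * g i)@_u); last by rewrite (global_tuple_syz du hg) mcoeff0.
by rewrite (raddf_sum (mcoeff u)); apply: eq_bigr => i _; rewrite !mxE mulr1.
Qed.

Lemma initial_supp u v i : initial u v -> ~~ (m i <= u)%MM -> v 0 i = 0.
Proof.
move=> [g [_ <- _]] nle; rewrite mxE mulrC; apply/eqP; rewrite mcoeff_eq0.
by apply: contra nle; rewrite (perm_mem (msuppMX _ _)) => /mapP[w _ ->]; apply: lem_addr.
Qed.

Lemma global_basis k h : (d <= k)%N -> is_h0 (twist (- d%:Z) F k%:Z) h ->
  exists G : 'I_h -> 'I_n -> {mpoly K[3]},
  [/\ forall j, global_tuple k (G j),
      forall g, global_tuple k g -> exists c : 'rV[K]_h, forall i, g i = \sum_j c 0 j *: G j i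
    & forall c : 'rV[K]_h, (forall i, \sum_j c 0 j *: G j i = 0) -> c = 0].
Proof.
move=> dk [b [bF bU]].
have /fin_all_exists[G GP] j : exists g, global_tuple k g /\
    forall x, x != 0 -> b j x = poly_row g x.
  have [g [hg bg _]] := twist_poly FE dk (bF j).
  exists g; split=> //; split=> //.
  by apply: (twist_ext sF _ (bF j)) => x x0; rewrite bg.
exists G; split=> [j|g [hg tg]|c hc]; first by case: (GP j).
  have [c [cP _]] := bU _ tg; exists (c) => i.
  apply: (poly_row_inj (g' := fun i => \sum_j c 0 j *: G j i)) => x x0.
  rewrite poly_row_comb cP //; apply: eq_bigr => j _.
  by rewrite (proj2 (GP j)).
have [c0 [_ uniq_c]] := bU _ (twist0 k sF).
rewrite -(uniq_c 0) => [|x x0]; last by rewrite big1 // => j _; rewrite mxE scale0r.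
apply/esym/uniq_c => x x0.
transitivity (poly_row (fun i => \sum_j c 0 j *: G j i) x).
  by apply/rowP => i; rewrite !mxE hc ev0.
by rewrite poly_row_comb; apply: eq_bigr => j _; rewrite (proj2 (GP j)).
Qed.

(** The coefficients at all monomials of degree [k] determine a tuple, so the common kernel for a
    basis of sections is zero and the ranks add up to [h]. *)
Lemma initial_spaces k h : (d <= k)%N -> is_h0 (twist (- d%:Z) F k%:Z) h ->
  exists I : 'X_{1..3} -> 'M[K]_n,
    (forall u v, mdeg u = k -> (v <= I u)%MS <-> initial u v) /\
    (\sum_(u <- mons k) \rank (I u) = h)%N.
Proof.
move=> dk /(global_basis dk)[G [hG genG freeG]].
pose A u : 'M[K]_(h, n) := \matrix_(j, i) fine_coef (G j) u 0 i.
have AE (c : 'rV_h) u : c *m A u = fine_coef (fun i => \sum_j c 0 j *: G j i) u.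
  apply/rowP => i; rewrite !mxE mulr_sumr (raddf_sum (mcoeff u)).
  by apply: eq_bigr => j _; rewrite !mxE -mcoeffZ scalerAr.
have fineE g g' u : (forall i, g i = g' i) -> fine_coef g u = fine_coef g' u.
  by move=> gg'; apply/rowP => i; rewrite !mxE gg'.
exists (initial_mx A (mons k)); split=> [u v du|].
  have us : u \in mons k by rewrite mem_mons du.
  rewrite initial_mxP; split=> [[c [cu cw]]|[g [hg gu gw]]].
    exists (fun i => \sum_j c 0 j *: G j i); rewrite -AE du; split=> //.
      exact: global_tuple_comb.
    by move=> w dw lt_w; rewrite -AE; apply: cw; rewrite mem_take_mons // mem_mons dw eqxx.
  rewrite du in hg gw; have [c gc] := genG g hg; exists c; split.
    by rewrite AE -gu; apply: fineE => i; rewrite gc.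
  move=> w; rewrite mem_take_mons // mem_mons => /andP[/eqP dw lt_w].
  by rewrite AE -[RHS](gw w dw lt_w); apply: fineE => i; rewrite gc.
have := rank_flag A (mons_uniq k); suff -> : common_ker A (mons k) = 0.
  by rewrite mxrank0 addn0.
apply/eqP; rewrite -submx0; apply/row_subP => l.
have /common_kerP hc := row_sub l (common_ker A (mons k)).
rewrite (freeG (row l (common_ker A (mons k)))) ?sub0mx // => i.
have homi : \sum_j (row l (common_ker A (mons k))) 0 j *: G j i \is (k - d).-homog.
  by apply: rpred_sum => j _; apply: dhomogZ; case: (hG j).
apply/mpolyP => w; rewrite mcoeff0.
have [dw|dw] := eqVneq (mdeg w) (k - d)%N; last exact: dhomog_nemf_coeff dw.
have := hc (w + m i)%MM; rewrite mem_mons mdegD dw m_deg subnK // eqxx => /(_ isT).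
by rewrite AE => /rowP/(_ i); rewrite !mxE mulrC addmC mcoeffMX.
Qed.

Lemma subsheaf_c1_bound (delta r : nat) (c : int) :
  (forall (C : {set 'I_n}) (e : 'I_3 -> nat),
    (2 <= #|C| < n)%N -> (forall i j, i \in C -> (e j <= m i j)%N) ->
    (d * #|C|.-1 + delta <= n.-1 * (d - \sum_j e j))%N) ->
  is_rank F r -> (0 < r < n.-1)%N -> is_c1 (- d%:Z) F c ->
  (n * d * r + delta)%N%:Z <= - (n.-1%:Z * c).
Proof.
move=> crit rF /andP[r0 rn] [r' [r'F [k0 [a hilbF]]]].
have rr' : r' = r by apply: rank_unique sF r'F rF.
subst r'.
pose k1 := maxn k0 d.
(* The absolute value only yields a [nat]: from [k0] on the polynomial is a dimension, hence
   nonnegative. *)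
pose hilb k := absz (r%:Z * 'C(k + 2, 2)%:Z + c * k%:Z + a).
have hilbP k : (k1 <= k)%N -> is_h0 (twist (- d%:Z) F k%:Z) (hilb k) /\
    (hilb k)%:Z = r%:Z * 'C(k + 2, 2)%:Z + c * k%:Z + a.
  by rewrite geq_max => /andP[kk0 _]; have [h hE hk] := hilbF k kk0; rewrite /hilb -hk.
have dk1 k : (k1 <= k)%N -> (d <= k)%N by rewrite geq_max => /andP[].
have [W [k2 [W1 hW]]] := @degeneration K n d m initial k1 hilb
  (fun k kk1 => initial_spaces (dk1 k kk1) (proj1 (hilbP k kk1)))
  (fun u w v ku => initial_mono w (dk1 _ ku)) initial_supp
  (fun u v ku => initial_sum (dk1 _ ku)).
have [rkW le_c] := hilbert_compare (fun k kk1 => proj2 (hilbP k kk1))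
  (fun k kk2 => proj1 (hW k kk2)) (fun k kk2 => proj2 (hW k kk2)).
have a_deg i : (\sum_j m i j = d)%N by rewrite -mdegE m_deg.
have rn' : (\rank W < n.-1)%N by rewrite rkW.
have := phi_ge a_deg crit W1 rn'; rewrite rkW r0 mul1n.
set p := phi _ _ _ in le_c *; move=> le_p; apply: (@le_trans _ _ (n.-1 * p)%N%:Z); first by rewrite lez_nat.
by rewrite PoszM -mulrN; apply: ler_wpM2l => //; rewrite lerNr.
Qed.
End SubsheafBound.

(** * The stability criterion *)

Lemma slope_compare (n d r delta : nat) (c : int) : (0 < r)%N -> (0 < n.-1)%N ->
  (n * d * r + delta)%N%:Z <= - (n.-1%:Z * c) ->
  let mu := (- (n * d)%N%:Z)%:~R / n.-1%:R : rat in
  c%:~R / r%:R <= mu /\ ((0 < delta)%N -> c%:~R / r%:R < mu).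
Proof.
move=> r0 n0 le_c mu; have r0' : (0 : rat) < r%:R by rewrite ltr0n.
have n0' : (0 : rat) < n.-1%:R by rewrite ltr0n.
rewrite /mu ler_pdivrMr // mulrAC ler_pdivlMr // ltr_pdivrMr // mulrAC ltr_pdivlMr //.
rewrite -[r%:R]/(r%:Z%:~R) -[n.-1%:R]/(n.-1%:Z%:~R) -!intrM ler_int ltr_int.
by split=> [|d0]; move: le_c; rewrite !PoszD !PoszM; lia.
Qed.

Section Criterion.
Variables (K : closedFieldType) (n d : nat) (m : 'I_n -> 'X_{1..3}).
Hypothesis n_gt2 : (2 < n)%N.
Hypothesis m_deg : forall i, mdeg (m i) = d.
Variable vtx : 'I_3 -> 'I_n.
Hypothesis m_vtx : forall j, m (vtx j) = (U_(j) *+ d)%MM.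
Variable delta : nat.
Hypothesis crit : forall (C : {set 'I_n}) (e : 'I_3 -> nat),
    (2 <= #|C| < n)%N -> (forall i j, i \in C -> (e j <= m i j)%N) ->
    (d * #|C|.-1 + delta <= n.-1 * (d - \sum_j e j))%N.
Local Notation E := (Syz d (monomials K m)).

Let muE : rat := (- (n * d)%N%:Z)%:~R / n.-1%:R.

Lemma monomial_Syz_rank : is_rank E n.-1.
Proof. exact: (Syz_rank (monomials_homog K m_deg) (monomials_vtx K m_vtx)). Qed.

Lemma monomial_Syz_coherent : coherent_subsheaf (- d%:Z) E.
Proof. exact: (Syz_coherent (monomials_homog K m_deg) (monomials_vtx K m_vtx)). Qed.

Lemma monomial_Syz_slope : is_slope (- d%:Z) E muE.
Proof.
exists n.-1, (- (n * d)%N%:Z); split=> //; first by lia.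
- exact: monomial_Syz_rank.
- by apply: (Syz_c1 K m_deg m_vtx); lia.
Qed.

Lemma subsheaf_slope (F : sections K n) r muF : coherent_subsheaf (- d%:Z) F ->
  sub_sections F E -> is_rank F r -> (0 < r < n.-1)%N -> is_slope (- d%:Z) F muF ->
  muF <= muE /\ ((0 < delta)%N -> muF < muE).
Proof.
move=> [sF _] FE rF rn [r' [c [_ r'F c1F ->]]].
have <- : r = r' by apply: rank_unique sF rF r'F.
have := subsheaf_c1_bound m_deg sF FE crit rF rn c1F.
by apply: slope_compare; lia.
Qed.

Lemma criterion_semistable : semistable (- d%:Z) E.
Proof.
split; first exact: monomial_Syz_coherent.
exists n.-1, muE; split; [exact: monomial_Syz_rank | exact: monomial_Syz_slope |].
by move=> F r muF cF FE rF rn sl; have [] := subsheaf_slope cF FE rF rn sl.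
Qed.

Lemma criterion_stable : (0 < delta)%N -> stable (- d%:Z) E.
Proof.
move=> d0; split; first exact: monomial_Syz_coherent.
exists n.-1, muE; split; [exact: monomial_Syz_rank | exact: monomial_Syz_slope |].
by move=> F r muF cF FE rF rn sl; have [_] := subsheaf_slope cF FE rF rn sl; apply.
Qed.
End Criterion.

Definition point_mon (d : nat) (p : nat * nat) : 'X_{1..3} :=
  [multinom nth 0%N [:: p.1; p.2; d - p.1 - p.2]%N i | i < 3].

Section Family.
Variables (d n : nat) (s : seq (nat * nat)).
Hypothesis n_gt2 : (2 < n)%N.
Hypothesis d_gt0 : (0 < d)%N.
Hypothesis size_s : size s = n.
Variable delta : nat.
Hypothesis delta_le1 : (delta <= 1)%N.
Hypothesis bal : balanced d delta s.

Definition point_family (i : 'I_n) : 'X_{1..3} := point_mon d (nth (0, 0)%N s i).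

Lemma nth_mem_s (i : 'I_n) : nth (0, 0)%N s i \in s.
Proof. by rewrite mem_nth // size_s. Qed.

Lemma family_deg i : mdeg (point_family i) = d.
Proof.
have [_ /(_ _ (nth_mem_s i)) le _ _] := bal.
by rewrite mdegE !big_ord_recl big_ord0 !mnmE /=; lia.
Qed.

Lemma family_inj : injective point_family.
Proof.
move=> i j /mnmP eq_ij; have [us _ _ _] := bal.
apply/val_inj/eqP; rewrite -(nth_uniq (0, 0)%N _ _ us) ?size_s ?ltn_ord //.
have := eq_ij 0; have := eq_ij (lift ord0 0); rewrite !mnmE /=.
by move: (nth _ s i) (nth _ s j) => [a b] [a' b'] /= -> ->.
Qed.

Lemma family_mem p : p \in s -> exists i, point_family i = point_mon d p.
Proof.
move=> ps; have lt : (index p s < n)%N by rewrite -size_s index_mem.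
by exists (Ordinal lt); rewrite /point_family /= nth_index.
Qed.

Lemma family_vertices : exists vtx : 'I_3 -> 'I_n, forall j, point_family (vtx j) = (U_(j) *+ d)%MM.
Proof.
have [_ _ [v0 v1 v2] _] := bal.
apply: (@fin_all_exists _ (fun=> 'I_n) (fun j i => point_family i = (U_(j) *+ d)%MM)) => j.
have [i ij] : exists i, point_family i = point_mon d (d * (val j == 0), d * (val j == 1))%N.
  apply: family_mem.
  by case: j => [[|[|[|j]]] lj] //=; rewrite ?muln0 ?muln1.
exists i; rewrite ij; apply/mnmP => l; rewrite mnmE mulmnE mnm1E /=.
by case: j {ij} => [[|[|[|j]]] lj] //=; case: l => [[|[|[|l]]] ll] //=; lia.
Qed.

(** Two extreme cases lie outside [balanced]: for [\sum_j e j = 0] the bound follows from [#|C| < n]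
    and [delta <= 1 <= d]; for [\sum_j e j >= d] all members of [C] would coincide, against
    injectivity. *)
Lemma family_crit (C : {set 'I_n}) (e : 'I_3 -> nat) :
    (2 <= #|C| < n)%N -> (forall i j, i \in C -> (e j <= point_family i j)%N) ->
    (d * #|C|.-1 + delta <= n.-1 * (d - \sum_j e j))%N.
Proof.
move=> /andP[C2 Cn] eC; set E := (\sum_j e j)%N.
have [E0|E0] := posnP E.
  rewrite E0 subn0 mulnC; have : (#|C|.-1.+1 * d <= n.-1 * d)%N by rewrite leq_mul2r; lia.
  by rewrite mulSn; lia.
have [ltE|geE] := ltnP E d; last first.
  have /card_gt1P[i [i' [iC i'C ne]]] := C2.
  suff eqe l : l \in C -> forall j, point_family l j = e j.
    case/eqP: ne; apply: family_inj; apply/mnmP => j.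
    by rewrite !eqe.
  move=> lC j; apply/eqP; rewrite eqn_leq eC // andbT.
  have := family_deg l; rewrite mdegE (bigD1 j) //=.
  have : (\sum_(j' | j' != j) e j' <= \sum_(j' | j' != j) point_family l j')%N.
    by apply: leq_sum => j' _; apply: eC.
  have := geE; rewrite /E (bigD1 j) //=.
  lia.
pose x := e 0; pose y := e (lift ord0 0); pose z := e (lift ord0 (lift ord0 0)).
have EE : E = (x + y + z)%N by rewrite /E !big_ord_recl big_ord0 addn0 addnA.
have [_ _ _ /(_ x y z)] := bal; rewrite -EE size_s E0 ltE => /(_ isT).
suff : (#|C| <= count (in_corner d x y z) s)%N.
  move=> le; have : (d * #|C| <= d * count (in_corner d x y z) s)%N by rewrite leq_mul2l le orbT.
  have -> : #|C| = #|C|.-1.+1 by lia.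
  by rewrite mulnS; lia.
rewrite -sum1_count (big_nth (0, 0)%N) size_s big_mkord sum1_card.
apply: subset_leq_card; apply/subsetP => i iC; rewrite unfold_in /in_corner.
have := eC i 0 iC; have := eC i (lift ord0 0) iC; have := eC i (lift ord0 (lift ord0 0)) iC.
rewrite !mnmE /= -/x -/y -/z => hz hy hx; rewrite hx hy /=.
have [_ /(_ _ (nth_mem_s i)) le _ _] := bal.
by lia.
Qed.
End Family.

Lemma balanced_family (K : closedFieldType) (d n delta : nat) s : (2 < n)%N -> (0 < d)%N ->
  size s = n -> (delta <= 1)%N -> balanced d delta s ->
  exists m : 'I_n -> 'X_{1..3},
    [/\ monomial_family d m, m_primary (monomials K m),
        semistable (- d%:Z)%R (Syz d (monomials K m)) &
        (0 < delta)%N -> stable (- d%:Z)%R (Syz d (monomials K m))].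
Proof.
move=> n2 d0 sz d1 bal; have [vtx hv] := family_vertices n2 d0 sz d1 bal.
have hdeg := family_deg n2 d0 sz d1 bal; have hc := family_crit n2 d0 sz d1 bal.
exists (point_family d s); split.
- by split=> //; apply: family_inj sz _ bal.
- exact: (monomials_m_primary K d0 hdeg hv).
- exact: (criterion_semistable K n2 hdeg hv hc).
- exact: (criterion_stable K n2 hdeg hv hc).
Qed.

Local Close Scope ring_scope.

Theorem theorem2p8 (K : closedFieldType) (d n : nat)
    (hn : (3 <= n <= 'C(d + 2, 2))%N) :
  ((d, n) <> (2, 5)%N ->
     exists m : 'I_n -> 'X_{1..3},
       [/\ monomial_family d m, m_primary (monomials K m) &
           stable (- d%:Z)%R (Syz d (monomials K m))]) /\
  ((d, n) = (2, 5)%N ->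
     exists m : 'I_n -> 'X_{1..3},
       [/\ monomial_family d m, m_primary (monomials K m) &
           semistable (- d%:Z)%R (Syz d (monomials K m))]).
Proof.
have [n3 _] := andP hn.
(* In degree 0 there is a single monomial, against [n >= 3]. *)
have d0 : (0 < d)%N by case: d hn => // /andP[]; rewrite add0n binn; case: n n3 => [|[|]].
split=> [dn|[d2 n5]].
  have [s sz bal] := exists_balanced d0 hn dn.
  have [m [fam prim _ st]] := @balanced_family K d n 1 s n3 d0 sz (leqnn 1) bal.
  by exists m; split=> //; apply: st.
subst d n; have [m [fam prim sst _]] := balanced_family K n3 d0 (erefl : size [:: (2, 0); (0, 2); (0, 0); (1, 1); (1, 0)] = 5)
  (leq0n 1) balanced2_5.
by exists m.
Qed.
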